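(* Let $\mathcal{H},\mathcal{H}_1,\ldots,\mathcal{H}_n$ be separable Hilbert spaces. A) The set $\mathfrak{S}_{\mathsf{FA}}(\mathcal{H})$ of states on $\mathcal{H}$ having the FA-property is convex. B) If $\rho_{1\ldots n}$ is a state in $\mathfrak{S}(\mathcal{H}_1\otimes\cdots\otimes\mathcal{H}_n)$ such that its marginal states satisfy $\rho_k\in\mathfrak{S}_{\mathsf{FA}}(\mathcal{H}_k)$ for all $k=1,\ldots,n$, then $\rho_{1\ldots n}\in\mathfrak{S}_{\mathsf{FA}}(\mathcal{H}_1\otimes\cdots\otimes\mathcal{H}_n)$. A product state $\rho_1\otimes\cdots\otimes\rho_n$ (with $\rho_k\in\mathfrak{S}(\mathcal{H}_k)$) belongs to $\mathfrak{S}_{\mathsf{FA}}(\mathcal{H}_1\otimes\cdots\otimes\mathcal{H}_n)$ if and only if $\rho_k\in\mathfrak{S}_{\mathsf{FA}}(\mathcal{H}_k)$ for all $k=1,\ldots,n$.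
   Context: A state on $\mathcal{H}$ is a positive trace-class operator with unit trace; $\mathfrak{S}(\mathcal{H})$ is the set of all states. $\{\lambda^{\rho}_i\}_{i\ge1}$ denotes the non-increasing sequence of eigenvalues of $\rho$ counted with multiplicity (the positive eigenvalues, followed by zeros if $\rho$ has finite rank). FA-property: it holds for a state $\rho$ if there is a sequence $\{g_i\}_{i\ge1}$ of nonnegative numbers such that $\sum_{i=1}^{+\infty}\lambda^{\rho}_i g_i<+\infty$ and $\lim_{\beta\to0^+}\left[\sum_{i=1}^{+\infty}e^{-\beta g_i}\right]^{\beta}=1$. The set of states in $\mathfrak{S}(\mathcal{H})$ with the FA-property is denoted $\mathfrak{S}_{\mathsf{FA}}(\mathcal{H})$. The marginal state $\rho_k$ of $\rho_{1\ldots n}$ is the partial trace of $\rho_{1\ldots n}$ over all the tensor factors except $\mathcal{H}_k$. *)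

(* Defs.v *)
From HB Require Import structures.
From mathcomp Require Import all_boot all_order all_algebra.
From mathcomp Require Import complex sesquilinear.
From mathcomp Require Import all_classical all_reals all_analysis.
From mathcomp.analysis.showcase Require Import summability.

Set Implicit Arguments.
Unset Strict Implicit.
Unset Printing Implicit Defensive.

Import Order.TTheory GRing.Theory Num.Theory.
Import numFieldNormedType.Exports.

Local Open Scope classical_set_scope.
Local Open Scope ring_scope.
Local Open Scope complex_scope.

(* The inner product is linear in its first argument and conjugate-linear in
   its second one. *)
HB.mixin Record CompleteNormedModule_isHilbert (R : realType) H
    of CompleteNormedModule R[i] H := {
  hdot : {dot H for (@Num.conj R[i])} ;
  hdot_norm : forall x : H, `|x| ^+ 2 = hdot x x
}.

#[short(type="hilbertType")]
HB.structure Definition Hilbert (R : realType) :=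
  { H of CompleteNormedModule_isHilbert R H & CompleteNormedModule R[i] H }.

Section sums.
Context {R : realType}.

(* Unconditional summation: the limit of the finite partial sums along the
   net of all finite subsets of D. *)
Definition has_sum {I : choiceType} (D : set I) (f : I -> R[i]^o) (s : R[i]^o) :=
  partial_sum (patch (fun=> 0) D f) @ totally --> s.

End sums.

Section hilbert_space.
Context {R : realType} {H : hilbertType R}.
Implicit Types (A rho : H -> H) (E V : set H).

Definition separable_space (T : topologicalType) :=
  exists2 D : set T, countable D & dense D.

Definition lspan E : set H :=
  [set x | exists (m : nat) (c : 'I_m -> R[i]) (v : 'I_m -> H),
    (forall i, E (v i)) /\ x = \sum_i c i *: v i].

Definition lin_indep (m : nat) (v : 'I_m -> H) :=
  forall c : 'I_m -> R[i], \sum_i c i *: v i = 0 -> forall i, c i = 0.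

Definition has_dim V (m : nat) :=
  exists2 v : 'I_m -> H, lin_indep v & V = lspan (range v).

Definition orthonormal_basis E :=
  (forall x y, E x -> E y -> hdot x y = (x == y)%:R) /\ dense (lspan E).

Definition bounded_operator A :=
  linear A /\ exists M : R[i], forall x, `|A x| <= M * `|x|.

Definition positive_operator A := forall x, 0 <= hdot (A x) x.

Definition has_trace A (t : R[i]) :=
  forall E, orthonormal_basis E -> has_sum E (fun e => hdot (A e) e) t.

(* P = |A|: the positive operator with P^2 = A^* A, the latter identity being
   expressed without adjoints. *)
Definition absolute_value A P :=
  [/\ bounded_operator P, positive_operator P &
      forall x y, hdot (P x) (P y) = hdot (A x) (A y)].

Definition trace_class A :=
  bounded_operator A /\
  exists P, absolute_value A P /\ exists t, has_trace P t.

Definition states : set (H -> H) :=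
  [set rho | [/\ positive_operator rho, trace_class rho & has_trace rho 1]].

Definition eigenspace A (t : R) : set H := [set x | A x = t%:C *: x].

(* The last clause counts multiplicities; being nonincreasing, lam takes only
   positive values when A has infinite rank, and ends with zeros otherwise. *)
Definition eigenvalue_sequence A (lam : nat -> R) :=
  [/\ nonincreasing_seq lam, (forall i, 0 <= lam i) &
      forall t : R, 0 < t ->
        exists2 m, has_dim (eigenspace A t) m & ([set i | lam i = t] #= `I_m)%card].

(* The series are valued in the extended reals, with (+oo) `^ b = +oo for
   b > 0. *)
Definition FA_property rho :=
  exists2 lam : nat -> R, eigenvalue_sequence rho lam &
  exists g : nat -> R,
    [/\ forall i, 0 <= g i,
        (\sum_(0 <= i <oo) (lam i * g i)%:E < +oo)%E &
        ((\sum_(0 <= i <oo) (expR (- b * g i))%:E) `^ b)%E @[b --> 0^'+]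
          --> 1%:E].

Definition FA_states : set (H -> H) :=
  [set rho | states rho /\ FA_property rho].

End hilbert_space.
Arguments separable_space : clear implicits.
Arguments states {R} H.
Arguments FA_states {R} H.

(* The Hilbert space tensor product of H_1, ..., H_n, determined up to a
   unitary by these properties.  dfwith u k x is u with its k-th component
   replaced by x. *)
Record hilbert_tensor (R : realType) (n : nat) (H : 'I_n -> hilbertType R) :=
  HilbertTensor {
    tensor_space :> hilbertType R ;
    tens : (forall k, H k) -> tensor_space ;
    tens_multilinear : forall (u : forall k, H k) (k : 'I_n) (a : R[i])
        (x y : H k),
      tens (dfwith u k (a *: x + y)) =
      a *: tens (dfwith u k x) + tens (dfwith u k y) ;
    tens_hdot : forall u v : forall k, H k,
      hdot (tens u) (tens v) = \prod_(k < n) hdot (u k) (v k) ;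
    tens_dense : dense (lspan (range tens))
  }.

Section tensor.
Context {R : realType} {n : nat} {H : 'I_n -> hilbertType R}.
Variable T : hilbert_tensor H.

(* sigma is the partial trace of rho over all factors but the k-th one.  The
   families u range over a product orthonormal basis of the other factors; the
   dummy value u k = 0 is overwritten. *)
Definition marginal (rho : T -> T) (k : 'I_n) (sigma : H k -> H k) :=
  forall E : forall l, set (H l), (forall l, orthonormal_basis (E l)) ->
  forall x y : H k,
    has_sum [set u : forall l, H l |
               u k = 0 /\ forall l, l != k -> E l (u l)]
      (fun u => hdot (rho (tens T (dfwith u k x))) (tens T (dfwith u k y)))
      (hdot (sigma x) y).

Definition tensor_operator (rho_ : forall k, H k -> H k) (rho : T -> T) :=
  bounded_operator rho /\
  forall u : forall k, H k, rho (tens T u) = tens T (fun k => rho_ k (u k)).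

End tensor.
Arguments marginal {R n H T} rho k sigma.

(* Main.v *)
Require Import Defs.
From mathcomp Require Import all_boot all_order all_algebra.
From mathcomp Require Import complex finmap.
From mathcomp.analysis.showcase Require Import summability.
From mathcomp Require Import all_classical all_reals all_analysis.
From mathcomp Require Import ring lra zify.

(* The FA-property of eigenvalues l_i with tails t(m) = sum_(i >= m) l_i amounts
   to sum_j j t(a^j) < +oo for some a > 1, that is, to
   sum_i l_i (ln i)^2 < +oo.  If it holds with weights g_i, then Markov's
   inequality at b = 1 / j shows that at most 16^j of the g_i are <= j^2 for
   large j, so that t(16^j) is at most the sum of the l_i with g_i > j^2, and
   sum_j j [j^2 < g_i] <= g_i.  Conversely, g_i = sum_(j : a^j <= i) c_j j works
   for weights c_j -> +oo that keep sum_j c_j j t(a^j) finite.  The tail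
   condition is stable under polynomial changes of the index m, hence:
   - convexity follows from Weyl's inequality, which bounds the tail of a convex
     combination at 2m by the tails of the two states at m;
   - the m^n products of the first m eigenvectors of the marginals carry, by
     Ky Fan's principle, at most the sum of the first m^n eigenvalues of the
     joint state, and they miss at most the sum of the marginal tails at m;
   - the eigenvalues of a product state dominate a constant times those of each
     factor. *)

Set Implicit Arguments.
Unset Strict Implicit.
Unset Printing Implicit Defensive.

Import Order.TTheory GRing.Theory Num.Theory.
Import numFieldNormedType.Exports.

Local Open Scope classical_set_scope.
Local Open Scope ring_scope.

(** * The FA-property for sequences *)

Section log_tail.
Context {R : realType}.
Implicit Types (l a g : nat -> R).

(** Interchanging the sums turns [sum_j j t(a^j)] into [sum_i l_i sum_(j : a^j <= i) j], whose inner
    sum is of order (ln i)^2. The square is what the limit forces: [Z(b)^b -> 1] means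
    [b ln Z(b) -> 0], and for [g_i = K (ln i)^2] completing the square leaves about [1 / (4 b K)] in
    [ln Z(b)], so no fixed K is enough; hence the factors c_j -> +oo. The criterion is stated with
    tails because variational principles bound sums of eigenvalues, and because it mentions no
    weights: the weights of two states are indexed by unrelated spectra and do not combine in an
    evident way. On the operator side, [eigenvalue_sequence] only prescribes dimensions of
    eigenspaces; it provides neither eigenvectors nor the sum of the eigenvalues. Each positive
    operator of finite trace is therefore first given a spectral decomposition, by compactness, and
    the uniqueness of eigenvalue sequences lets the FA-property be read off from it. *)

Definition tail l m : \bar R := (\sum_(m <= i <oo) (l i)%:E)%E.

(** The base is existential because comparing tails at distorted indices changes it. *)
Definition log_tail l :=
  exists2 a : nat, (1 < a)%N &
    (\sum_(0 <= j <oo) (j%:R%:E * tail l (a ^ j)) < +oo)%E.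

Lemma nneseries_le (u : nat -> \bar R) m x : (forall i, 0 <= u i)%E ->
  (forall n, \sum_(m <= i < n) u i <= x)%E -> (\sum_(m <= i <oo) u i <= x)%E.
Proof.
move=> u0 ux; apply: lime_le; first exact: is_cvg_nneseries.
by apply: nearW => n; exact: ux.
Qed.

Lemma tail_ge0 l m : (forall i, 0 <= l i) -> (0 <= tail l m)%E.
Proof. by move=> l0; apply: nneseries_ge0 => i _ _; rewrite lee_fin. Qed.

Lemma tailD l m : (forall i, 0 <= l i) ->
  (tail l 0 = (\sum_(0 <= i < m) l i)%:E + tail l m)%E.
Proof.
move=> l0; rewrite /tail (@nneseries_split _ _ 0%N m) ?add0n.
  by rewrite sumEFin.
by move=> i _; rewrite lee_fin.
Qed.

Lemma tail_anti l m n : (forall i, 0 <= l i) -> (m <= n)%N ->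
  (tail l n <= tail l m)%E.
Proof.
move=> l0 mn; rewrite /tail (@nneseries_split _ _ m (n - m)); last first.
  by move=> i _; rewrite lee_fin.
rewrite subnKC// leeDr// sumEFin lee_fin.
by apply: sumr_ge0.
Qed.

(** The bathtub principle: a mass at most [k] with density at most 1 does best on the first [k]
    indices. Once [l k] is subtracted from [l], the terms are nonnegative before [k] and nonpositive
    after it, so the comparison is termwise. It serves both the counting argument of [FA_log_tail]
    and [ky_fan]. *)
Lemma bathtub l a k N : nonincreasing_seq l -> (forall i, 0 <= l i) ->
  (forall i, 0 <= a i <= 1) -> \sum_(0 <= i < N) a i <= k%:R ->
  \sum_(0 <= i < N) l i * a i <= \sum_(0 <= i < k) l i.
Proof.
move=> dl l0 a01 ak.
have H : \sum_(0 <= i < N) (l i - l k) * a i <= \sum_(0 <= i < k) (l i - l k).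
  apply: (@le_trans _ _ (\sum_(0 <= i < N) (if (i < k)%N then l i - l k else 0))).
    apply: ler_sum => i _; have /andP[ai0 ai1] := a01 i; case: ltnP => ik.
      by rewrite ler_piMr// subr_ge0; exact/dl/ltnW.
    by rewrite mulr_le0_ge0// subr_le0; exact: dl.
  have d0 i : (i < k)%N -> 0 <= l i - l k by move=> ik; rewrite subr_ge0 dl// ltnW.
  case: (leqP N k) => [Nk|/ltnW kN].
    rewrite [leRHS](big_cat_nat _ Nk)//= -[leLHS]addr0 lerD//.
      by apply: ler_sum_nat => i /andP[_ iN]; rewrite (leq_trans iN Nk).
    by rewrite big_nat_cond sumr_ge0// => i /andP[/andP[_ ik] _]; exact: d0.
  rewrite [leLHS](big_cat_nat _ kN)//= -[leRHS]addr0 lerD//.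
    by apply: ler_sum_nat => i /andP[_ ->].
  by rewrite big_nat_cond sumr_le0// => i /andP[/andP[ki _] _]; rewrite ltnNge ki.
move: H; rewrite sumrB sumr_const_nat subn0 -mulr_natl.
under eq_bigr do rewrite mulrBl.
rewrite sumrB -mulr_sumr => H.
have := ler_wpM2l (l0 k) ak; lra.
Qed.

(** The layers with [j ^ 2 < x] form an initial segment, and [0 + ... + m <= m ^ 2 < x] for the last
    of them. *)
Lemma sum_sqrt_layers (x : R) n : 0 <= x ->
  \sum_(0 <= j < n) (if j%:R ^+ 2 < x then j%:R else 0) <= x.
Proof.
move=> x0.
have S m : \sum_(0 <= j < m.+1) j%:R <= m%:R ^+ 2 :> R.
  elim: m => [|m IH]; first by rewrite big_nat1 expr2 mul0r.
  rewrite big_nat_recr//=; apply: le_trans (lerD IH (lexx _)) _.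
  rewrite -!natrX -!natrD ler_nat; nia.
elim: n => [|n IH]; first by rewrite big_geq.
case: (ltP (n%:R ^+ 2) x) => nx; last first.
  by rewrite big_nat_recr//= ltNge nx addr0.
apply: le_trans (le_trans (S n) (ltW nx)).
by apply: ler_sum => i _; case: ifP.
Qed.

(** Only the upper half of the limit is used: near 0 the power is at most [1 + 1 <= expR 1], and
    raising to the power [1 / b] gives the bound. *)
Lemma FA_partition_bound g :
  ((\sum_(0 <= i <oo) (expR (- b * g i))%:E) `^ b)%E @[b --> 0^'+] --> 1%:E ->
  exists2 d : R, 0 < d & forall b, 0 < b < d ->
    (\sum_(0 <= i <oo) (expR (- b * g i))%:E <= (expR b^-1)%:E)%E.
Proof.
move=> /fine_cvgP[fn /cvgrPdist_lt/(_ 1 ltr01)] h.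
have: \forall b \near (0 : R)^'+, 0 < b /\
    (\sum_(0 <= i <oo) (expR (- b * g i))%:E <= (expR b^-1)%:E)%E.
  near=> b.
  have b0 : 0 < b by near: b; exact: nbhs_right_gt.
  split => //.
  have Ffin : (((\sum_(0 <= i <oo) (expR (- b * g i))%:E) `^ b) \is a fin_num)%E.
    by near: b; exact: fn.
  have Fe : ((\sum_(0 <= i <oo) (expR (- b * g i))%:E) `^ b <= (expR 1)%:E)%E.
    rewrite -(fineK Ffin) lee_fin (@le_trans _ _ (1 + 1))//; last exact: expR_ge1Dx.
    have : `|1 - fine ((\sum_(0 <= i <oo) (expR (- b * g i))%:E) `^ b)%E| < 1 by near: b; exact: h.
    by rewrite ltr_norml; lra.
  move: Ffin Fe; set F := (\sum_(0 <= i <oo) (expR (- b * g i))%:E)%E => Ffin Fe.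
  have F0 : (0 <= F)%E.
    by apply: nneseries_ge0 => i _ _; rewrite lee_fin expR_ge0.
  have -> : F = ((F `^ b) `^ b^-1)%E.
    by rewrite -poweRrM mulfV ?gt_eqF// poweRe1.
  have -> : (expR b^-1)%:E = ((expR 1)%:E `^ b^-1)%E.
    by rewrite poweR_EFin -expRM mul1r.
  apply: gt0_ler_poweR => //.
  - by rewrite invr_ge0 ltW.
  - by rewrite in_itv/= leey poweR_ge0.
  - by rewrite in_itv/= leey lee_fin expR_ge0.
rewrite /at_right near_withinE => /nbhs_ballP[d /= d0 H].
exists d => // b /andP[b0 bd]; have [] // := H b.
by rewrite /ball/= sub0r normrN gtr0_norm.
Unshelve. all: by end_near. Qed.

(** The origin of the base 16: [expR (1/2) <= 2] because [expR (- 1/2) >= 1/2], hence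
    [expR 2 <= 16]. *)
Lemma expR2n_le j : expR (2 * j%:R) <= (16 ^ j)%:R :> R.
Proof.
rewrite natrX -[2 * _]mulrC expRM_natl lerXn2r ?nnegrE ?expR_ge0//.
have e4 : expR 1 <= 4 :> R.
  have := @expR_ge1Dx R (-(1/2)) => h.
  have e0 := expR_gt0 (1/2 : R).
  have : expR (1/2) <= 2 :> R.
    have := mulfV (lt0r_neq0 e0); rewrite -expRN; nra.
  have -> : expR 1 = expR (1/2) * expR (1/2) :> R by rewrite -expRD; congr expR; lra.
  nra.
have -> : expR 2 = expR 1 * expR 1 :> R by rewrite -expRD; congr expR; lra.
have := expR_gt0 (1 : R); nra.
Qed.

Lemma FA_log_tail l g : nonincreasing_seq l -> (forall i, 0 <= l i) ->
  (tail l 0 < +oo)%E -> (forall i, 0 <= g i) ->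
  (\sum_(0 <= i <oo) (l i * g i)%:E < +oo)%E ->
  ((\sum_(0 <= i <oo) (expR (- b * g i))%:E) `^ b)%E @[b --> 0^'+] --> 1%:E ->
  log_tail l.
Proof.
move=> dl l0 lfin g0 lg /FA_partition_bound[d d0 Fd]; exists 16%N => //.
(* The mass of [l] on the indices with [g i > j ^ 2], which will dominate the tail at [16 ^ j]. *)
pose B j : \bar R := (\sum_(0 <= i <oo) (if j%:R ^+ 2 < g i then l i else 0)%:E)%E.
have B0 j : (0 <= B j)%E.
  by apply: nneseries_ge0 => i _ _; rewrite lee_fin; case: ifP.
have [J J0] : exists J, forall j, (J <= j)%N -> (tail l (16 ^ j) <= B j)%E.
  exists (Num.truncn d^-1).+1 => j Jj.
  have j0 : 0 < j%:R :> R by rewrite ltr0n; case: j Jj.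
  have jd : 0 < (j%:R : R)^-1 < d.
    rewrite invr_gt0 j0/= -[ltRHS]invrK ltf_pV2 ?posrE ?invr_gt0//.
    apply: lt_le_trans (truncnS_gt _) _.
    by rewrite ler_nat.
  (* An index with [g i <= j ^ 2] contributes at least [expR (- j)] to a partition sum that is at
     most [expR j], so at most [expR (2 j)] indices are of this kind. *)
  have cnt N : \sum_(0 <= i < N) (if j%:R ^+ 2 < g i then 0 else 1) <= (16 ^ j)%:R :> R.
    apply: le_trans (expR2n_le j).
    have -> : 2 * j%:R = j%:R + j%:R :> R by ring.
    rewrite expRD -ler_pdivrMr ?expR_gt0// -expRN mulr_suml.
    have := Fd _ jd; rewrite invrK => Fj.
    rewrite -lee_fin -sumEFin; apply: le_trans Fj.
    apply: le_trans (nneseries_lim_ge N _); last first.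
      by move=> i _ _; rewrite lee_fin expR_ge0.
    apply: lee_sum => i _; rewrite lee_fin; case: ltP => gi; first by rewrite mul0r expR_ge0.
    rewrite mul1r ler_expR mulNr lerN2 mulrC ler_pdivrMr//.
  (* By [bathtub], these indices carry no more than the first [16 ^ j] ones; comparing the two
     splittings of [tail l 0] reverses the inequality for the complements. *)
  have A1 : ((\sum_(0 <= i <oo) (if j%:R ^+ 2 < g i then 0 else l i)%:E <=
      (\sum_(0 <= i < 16 ^ j) l i)%:E))%E.
    apply: nneseries_le => [i|N]; first by rewrite lee_fin; case: ifP.
    rewrite sumEFin lee_fin.
    have := @bathtub l (fun i => if j%:R ^+ 2 < g i then 0 else 1) _ N dl l0 _ (cnt N).
    under eq_bigr do rewrite fun_if mulr0 mulr1.
    by apply => i; case: ifP; rewrite ?lexx ?ler01.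
  have := tailD (16 ^ j) l0.
  have -> : tail l 0 = (\sum_(0 <= i <oo) (if j%:R ^+ 2 < g i then 0 else l i)%:E + B j)%E.
    rewrite -nneseriesD; last 2 first.
    - by move=> i _ _; rewrite lee_fin; case: ifP.
    - by move=> i _ _; rewrite lee_fin; case: ifP.
    by apply: eq_eseriesr => i _; case: ifP; rewrite ?adde0 ?add0e.
  move=> E; have := leeD A1 (lexx (B j)); rewrite E.
  by rewrite leeD2lE.
have T0 j : (0 <= j%:R%:E * tail l (16 ^ j))%E by rewrite mule_ge0 ?lee_fin ?tail_ge0.
rewrite (@nneseries_split _ _ 0%N J)// add0n lte_add_pinfty//.
  apply: lte_sum_pinfty => j _; rewrite lte_mul_pinfty ?lee_fin//.
  by apply: le_lt_trans lfin; exact: tail_anti.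
apply: le_lt_trans lg.
apply: (@le_trans _ _ (\sum_(0 <= j <oo) (j%:R%:E * B j))%E).
  apply: (@le_trans _ _ (\sum_(J <= j <oo) (j%:R%:E * B j))%E).
    rewrite eseries_cond [leRHS]eseries_cond; apply: lee_nneseries => // j Jj.
    by rewrite lee_wpmul2l ?lee_fin// J0.
  rewrite [leRHS](@nneseries_split _ _ 0%N J) ?add0n; last first.
    by move=> j _; rewrite mule_ge0 ?lee_fin.
  by rewrite leeDr// sume_ge0// => j _; rewrite mule_ge0 ?lee_fin.
under eq_eseriesr => j _.
  rewrite -nneseriesZl; last by move=> i _; rewrite lee_fin; case: ifP.
  under eq_eseriesr do rewrite -EFinM.
  over.
rewrite nneseries_interchange; last first.
  by move=> j i; rewrite lee_fin mulr_ge0//; case: ifP.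
apply: lee_nneseries => i _.
  by move=> _; apply: nneseries_ge0 => j _ _; rewrite lee_fin mulr_ge0//; case: ifP.
apply: nneseries_le => [j|n]; first by rewrite lee_fin mulr_ge0//; case: ifP.
rewrite sumEFin lee_fin.
rewrite [leLHS](_ : _ = l i * \sum_(0 <= j < n) (if j%:R ^+ 2 < g i then j%:R else 0)).
  by rewrite ler_wpM2l// sum_sqrt_layers.
by rewrite mulr_sumr; apply: eq_bigr => j _; case: ifP; rewrite ?mulr0// mulrC.
Qed.

(* c_j = 1 / sqrt r_j, where the r_j are the tails of b_j + 2^-(j+1) (so that
   r_j > 0); then c_j (r_j - r_(j+1)) <= 2 (sqrt r_j - sqrt r_(j+1)). *)
Lemma summable_weight (b : nat -> R) : (forall j, 0 <= b j) ->
  (\sum_(0 <= j <oo) (b j)%:E < +oo)%E ->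
  exists c : nat -> R, [/\ forall j, 0 <= c j,
    (\sum_(0 <= j <oo) (c j * b j)%:E < +oo)%E &
    forall K, exists J, forall j, (J <= j)%N -> K <= c j].
Proof.
move=> b0 bfin.
pose b' j : R := b j + 1 / (2 ^ (j + 1))%:R.
have h0 j : 0 < 1 / (2 ^ (j + 1))%:R :> R by rewrite divr_gt0// ltr0n expn_gt0.
have b'0 j : 0 <= b' j by rewrite addr_ge0// ltW.
have b'fin : (\sum_(0 <= j <oo) (b' j)%:E < +oo)%E.
  rewrite (@eq_eseriesr _ _ (fun j => (b j)%:E + (1 / (2 ^ (j + 1))%:R)%:E)%E)//.
  rewrite nneseriesD; last 2 first.
  - by move=> i _ _; rewrite lee_fin.
  - by move=> i _ _; rewrite lee_fin ltW.
  rewrite lte_add_pinfty//.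
  have -> : (\sum_(0 <= j <oo) (1 / (2 ^ (j + 1))%:R)%:E = (1 / 2 ^+ 0 : R)%:E)%E.
    exact/cvg_lim/cvg_geometric_eseries_half.
  by rewrite ltry.
have tfin j : tail b' j \is a fin_num.
  rewrite ge0_fin_numE ?tail_ge0//; apply: le_lt_trans b'fin; exact: tail_anti.
pose r j := fine (tail b' j).
have rE j : (r j)%:E = tail b' j by rewrite fineK.
have rS j : r j = b' j + r j.+1.
  apply: EFin_inj; rewrite EFinD !rE /tail (@nneseries_split _ _ j 1) ?addn1.
    by rewrite big_nat1.
  by move=> i _; rewrite lee_fin.
have r0 j : 0 < r j.
  rewrite rS ltr_wpDr//; first by rewrite -lee_fin rE tail_ge0.
  by rewrite ltr_wpDl.
exists (fun j => (Num.sqrt (r j))^-1); split => [j||K].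
- by rewrite invr_ge0 sqrtr_ge0.
- apply: (@le_lt_trans _ _ (2 * Num.sqrt (r 0%N))%:E); last by rewrite ltry.
  apply: nneseries_le => [j|n].
    by rewrite lee_fin mulr_ge0// invr_ge0 sqrtr_ge0.
  rewrite sumEFin lee_fin.
  apply: (@le_trans _ _ (2 * Num.sqrt (r 0%N) - 2 * Num.sqrt (r n))); last first.
    by rewrite gerBl mulr_ge0 ?sqrtr_ge0.
  elim: n => [|n IH]; first by rewrite big_geq// subrr.
  rewrite big_nat_recr//=.
  suff : (Num.sqrt (r n))^-1 * b n <= 2 * Num.sqrt (r n) - 2 * Num.sqrt (r n.+1).
    by move: IH; lra.
  have sn : 0 < Num.sqrt (r n) by rewrite sqrtr_gt0.
  rewrite mulrC ler_pdivrMr//.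
  have : b n <= Num.sqrt (r n) ^+ 2 - Num.sqrt (r n.+1) ^+ 2.
    by rewrite !sqr_sqrtr ?ltW// rS; have := h0 n; rewrite /b'; lra.
  have := sqr_ge0 (Num.sqrt (r n) - Num.sqrt (r n.+1)).
  nra.
(* For [K > 0] it suffices that [r j < K ^- 2], and the tails [r j] tend to 0. *)
- wlog K0 : K / 0 < K.
    move=> H; have [J HJ] := H (`|K| + 1) ltac:(have := normr_ge0 K; lra).
    by exists J => j /HJ; have := ler_norm K; lra.
  have := nneseries_tail_cvg b'fin (fun k _ => b'0 k).
  move=> /fine_cvgP[_ /cvgrPdist_lt/(_ (K ^- 2))].
  rewrite invr_gt0 exprn_gt0// => /(_ isT)[J _ HJ].
  exists J => j /HJ /=; rewrite sub0r normrN -/(tail b' j) -/(r j) gtr0_norm// => rK.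
  rewrite -[leLHS]invrK lef_pV2 ?posrE ?invr_gt0 ?sqrtr_gt0//.
  rewrite -[leRHS]gtr0_norm ?invr_gt0// -sqrtr_sqr ler_sqrt ?exprn_gt0 ?invr_gt0//.
  by rewrite exprVn ltW.
  exact: sqr_ge0.
Qed.

(** Induction on the sharper bound [2 - 1 / (n + 1)], which telescopes through
    [1 / (x + 1) ^ 2 <= 1 / x - 1 / (x + 1)]. *)
Lemma sum_inv_sqr_le n : \sum_(0 <= i < n) (i.+1%:R ^- 2) <= 2 :> R.
Proof.
case: n => [|n]; first by rewrite big_geq.
apply: (@le_trans _ _ (2 - n.+1%:R^-1)); last by rewrite gerBl invr_ge0.
elim: n => [|n IH]; first by rewrite big_nat1 expr1n invr1; lra.
rewrite big_nat_recr//=; apply: le_trans (lerD IH (lexx _)) _.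
have -> : n.+2%:R = n.+1%:R + 1 :> R by rewrite -[in LHS]natr1.
have : 0 < n.+1%:R :> R by rewrite ltr0n.
move: (n.+1%:R) => x x0.
have x10 : 0 < x + 1 by lra.
suff : 0 <= x^-1 - (x + 1)^-1 - (x + 1) ^- 2 by lra.
have -> : x^-1 - (x + 1)^-1 - (x + 1) ^- 2 = x^-1 * (x + 1) ^- 2.
  by field; rewrite !gt_eqF.
by rewrite mulr_ge0 ?invr_ge0 ?exprn_ge0// ltW.
Qed.

(* With g >= K j^2 - B on the block [a^j, a^(j+1)), completing the square
   gives (i + 1)^2 exp (- b g_i) <= exp (2 ln a + b B + (ln a)^2 / (b K)). *)
Lemma partition_function_le (a : nat) g (K B b : R) : (1 < a)%N -> 0 < K -> 0 <= B ->
  (forall i, 0 <= g i) ->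
  (forall i j, (a ^ j <= i)%N -> K * j%:R ^+ 2 - B <= g i) -> 0 < b ->
  (\sum_(0 <= i <oo) (expR (- b * g i))%:E <=
    (2 * expR (2 * ln a%:R + b * B + ln a%:R ^+ 2 / (b * K)))%:E)%E.
Proof.
move=> a1 K0 B0 g0 gK b0; set A := ln a%:R; set C := expR _.
have a0 : 0 < a%:R :> R by rewrite ltr0n; lia.
have A0 : 0 <= A by rewrite ln_ge0// ler1n; lia.
have C0 : 0 < C := expR_gt0 _.
apply: nneseries_le => [i|n]; first by rewrite lee_fin expR_ge0.
rewrite sumEFin lee_fin; apply: le_trans (ler_wpM2r (ltW C0) (sum_inv_sqr_le n)).
rewrite mulr_suml; apply: ler_sum => i _.
rewrite [leRHS]mulrC ler_pdivlMr ?exprn_gt0 ?ltr0n//.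
suff [j ij H] : exists2 j : nat, (i.+1 <= a ^ j.+1)%N & K * j%:R ^+ 2 - B <= g i.
  have iA : i.+1%:R ^+ 2 <= expR (2 * j.+1%:R * A).
    have -> : 2 * j.+1%:R * A = (j.+1 * 2)%:R * A by rewrite natrM mulrC [in RHS]mulrC; ring.
    rewrite expRM_natl lnK ?posrE// exprM lerXn2r ?nnegrE ?ler0n//.
    by rewrite -natrX ler_nat.
  apply: le_trans (ler_wpM2l (expR_ge0 _) iA) _.
  rewrite -expRD ler_expR -natr1.
  have bK : 0 < b * K by rewrite mulr_gt0.
  have H2 := ler_wpM2l (ltW b0) H.
  suff : 2 * j%:R * A <= b * K * j%:R ^+ 2 + A ^+ 2 / (b * K) by nra.
  rewrite -subr_ge0.
  have -> : b * K * j%:R ^+ 2 + A ^+ 2 / (b * K) - 2 * j%:R * A =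
    (b * K * j%:R - A) ^+ 2 / (b * K) by field; rewrite !gt_eqF.
  by rewrite divr_ge0 ?sqr_ge0// ltW.
(* Index 0 lies in no block [[a ^ j, a ^ (j + 1))]; it is served by [j = 0], as
   [- B <= 0 <= g 0]. *)
case: i => [|i].
  exists 0%N; rewrite ?expn1; first lia.
  by rewrite expr0n mulr0 sub0r (le_trans _ (g0 _))// oppr_le0.
exists (trunc_log a i.+1); first exact: trunc_log_ltn.
exact/gK/trunc_logP.
Qed.

(** The term of index 0 keeps the sum above 1. Above, [b] times the logarithm of the bound of
    [partition_function_le] is [b (ln 2 + 2 A + b B) + A ^ 2 / K]. The last term does not shrink
    with [b], so [K] is chosen first, then [B], which depends on [K], and [b] last. *)
Lemma FA_partition_limit (a : nat) g : (1 < a)%N -> g 0%N = 0 -> (forall i, 0 <= g i) ->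
  (forall K, 0 < K -> exists2 B, 0 <= B &
     forall i j, (a ^ j <= i)%N -> K * j%:R ^+ 2 - B <= g i) ->
  ((\sum_(0 <= i <oo) (expR (- b * g i))%:E) `^ b)%E @[b --> 0^'+] --> 1%:E.
Proof.
move=> a1 g00 g0 gK; set A := ln (a%:R : R).
have A0 : 0 <= A by rewrite ln_ge0// ler1n; lia.
suff H e : 0 < e -> \forall b \near (0 : R)^'+,
    (1 <= (\sum_(0 <= i <oo) (expR (- b * g i))%:E) `^ b <= (expR e)%:E)%E.
  apply/fine_cvgP; split.
    near=> b.
    have : (1 <= (\sum_(0 <= i <oo) (expR (- b * g i))%:E) `^ b <= (expR 1)%:E)%E.
      by near: b; exact: H.
    move=> /andP[h1 h2]; rewrite fin_numElt (lt_le_trans _ h1) ?ltNyr//=.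
    by rewrite (le_lt_trans h2) ?ltry.
  apply/cvgrPdist_le => e e0; near=> b.
  have : (1 <= (\sum_(0 <= i <oo) (expR (- b * g i))%:E) `^ b <= (expR (ln (1 + e)))%:E)%E.
    by near: b; apply: H; rewrite ln_gt0 ?ltrDl.
  rewrite lnK ?posrE ?addr_gt0//= => /andP[h1 h2].
  have fn : ((\sum_(0 <= i <oo) (expR (- b * g i))%:E) `^ b)%E \is a fin_num.
    rewrite fin_numElt (lt_le_trans _ h1) ?ltNyr//=.
    by rewrite (le_lt_trans h2) ?ltry.
  rewrite -(fineK fn) !lee_fin in h1 h2.
  by rewrite ler_distlC; apply/andP; split; lra.
move=> e0.
(* Makes [A ^ 2 / K <= e / 2]; the added 1 keeps [K] positive. *)
pose K := 2 * A ^+ 2 / e + 1.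
have K0 : 0 < K by rewrite ltr_wpDl// divr_ge0 ?mulr_ge0 ?sqr_ge0// ltW.
have [B B0 HB] := gK _ K0.
(* Dominates [ln 2 + 2 A + b B] for [b < 1], so that [b < e / (2 D)] settles the other half of
   [e]. *)
pose D := ln 2 + 2 * A + B.
have D0 : 0 < D.
  have : 0 < ln (2 : R) by rewrite ln_gt0// ltr1n.
  rewrite /D; lra.
near=> b.
have b0 : 0 < b by near: b; exact: nbhs_right_gt.
have b1 : b < 1 by near: b; exact: nbhs_right_lt.
have bD : b < e / (2 * D) by near: b; apply: nbhs_right_lt; rewrite divr_gt0 ?mulr_gt0.
have F1 : (1 <= \sum_(0 <= i <oo) (expR (- b * g i))%:E)%E.
  apply: le_trans (nneseries_lim_ge 1 _).
    by rewrite big_nat1 g00 mulr0 expR0.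
  by move=> i _ _; rewrite lee_fin expR_ge0.
have F2 := partition_function_le a1 K0 B0 g0 HB b0.
apply/andP; split.
  have {1}-> : (1 = 1 `^ b :> \bar R)%E by rewrite poweR1r.
  apply: gt0_ler_poweR; [exact: ltW| | |exact: F1].
    by rewrite in_itv/= leey andbT.
  by rewrite in_itv/= leey andbT; exact: le_trans F1.
apply: le_trans (gt0_ler_poweR (ltW b0) _ _ F2) _.
- by rewrite in_itv/= leey andbT; exact: le_trans F1.
- by rewrite in_itv/= leey andbT lee_fin mulr_ge0// expR_ge0.
have e2 : expR (ln 2) = 2 :> R by rewrite lnK ?posrE.
rewrite -[X in (X * expR _)%:E]e2 poweR_EFin -expRD -expRM lee_fin ler_expR.
rewrite -/A.
have -> : (ln 2 + (2 * A + b * B + A ^+ 2 / (b * K))) * b =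
  b * (ln 2 + 2 * A + b * B) + A ^+ 2 / K by field; rewrite !gt_eqF.
have h1 : A ^+ 2 / K <= e / 2.
  rewrite ler_pdivrMr// /K.
  have -> : e / 2 * (2 * A ^+ 2 / e + 1) = A ^+ 2 + e / 2 by field; rewrite gt_eqF.
  by rewrite lerDl; lra.
have h2 : b * D < e / 2.
  move: bD; rewrite ltr_pdivlMr ?mulr_gt0//; lra.
have : b * (ln 2 + 2 * A + b * B) <= b * D.
  rewrite ler_wpM2l ?(ltW b0)// /D; have := ler_piMl B0 (ltW b1); lra.
lra.
Unshelve. all: by end_near. Qed.

Lemma log_tail_FA l : (forall i, 0 <= l i) -> (tail l 0 < +oo)%E -> log_tail l ->
  exists g : nat -> R,
    [/\ forall i, 0 <= g i,
        (\sum_(0 <= i <oo) (l i * g i)%:E < +oo)%E &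
        ((\sum_(0 <= i <oo) (expR (- b * g i))%:E) `^ b)%E @[b --> 0^'+]
          --> 1%:E].
Proof.
move=> l0 lfin [a a1 la].
have tfin j : tail l j \is a fin_num.
  by rewrite ge0_fin_numE ?tail_ge0//; apply: le_lt_trans lfin; exact: tail_anti.
pose b j := j%:R * fine (tail l (a ^ j)).
have bE j : (b j)%:E = (j%:R%:E * tail l (a ^ j))%E by rewrite EFinM fineK.
have b0 j : 0 <= b j by rewrite mulr_ge0// fine_ge0// tail_ge0.
have bfin : (\sum_(0 <= j <oo) (b j)%:E < +oo)%E by under eq_eseriesr do rewrite bE.
have [c [c0 cb cK]] := summable_weight b0 bfin.
pose h i j := if (a ^ j <= i)%N then j%:R * c j else 0.
have h0 i j : 0 <= h i j by rewrite /h; case: ifP => _ //; rewrite mulr_ge0.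
(* Stopping at [i] loses nothing, since [a ^ j <= i] forces [j <= i]. *)
pose g i := \sum_(0 <= j < i.+1) h i j.
have g0 i : 0 <= g i by apply: sumr_ge0.
exists g; split => //.
  apply: le_lt_trans cb.
  (* Summed over [i] first, the double series is [sum_j c_j j t(a^j)], finite by the choice of
     [c]. *)
  apply: (@le_trans _ _ (\sum_(0 <= i <oo) \sum_(0 <= j <oo) (l i * h i j)%:E)%E).
    apply: lee_nneseries => i _; first by move=> _; rewrite lee_fin mulr_ge0.
    apply: le_trans (nneseries_lim_ge i.+1 _); last first.
      by move=> j _ _; rewrite lee_fin mulr_ge0.
    by rewrite sumEFin lee_fin /g mulr_sumr.
  rewrite nneseries_interchange; last by move=> i j; rewrite lee_fin mulr_ge0.
  apply: lee_nneseries => j _.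
    by move=> _; apply: nneseries_ge0 => i _ _; rewrite lee_fin mulr_ge0.
  rewrite EFinM bE muleA -EFinM [in leRHS]mulrC /tail.
  rewrite -nneseriesZl; last by move=> i _; rewrite lee_fin.
  rewrite [leRHS]eseries_cond [leRHS]eseries_mkcond/=; apply: lee_nneseries => i _.
    by move=> _; rewrite lee_fin mulr_ge0.
  by rewrite /h; case: ifP; rewrite ?mulr0// -EFinM mulrC.
apply: (FA_partition_limit a1) => //.
  by rewrite /g big_nat1 /h expn0.
(* From [J] on, the increment [j c_j >= 2 K j] exceeds [K (j ^ 2 - (j - 1) ^ 2)]; up to [J], the
   constant [K J ^ 2] makes the lower bound nonpositive. *)
move=> K K0; have [J HJ] := cK (2 * K).
exists (K * J%:R ^+ 2); first by rewrite mulr_ge0 ?sqr_ge0// ltW.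
move=> i j aji.
have ji : (j < i.+1)%N by have := ltn_expl j a1; lia.
apply: (@le_trans _ _ (\sum_(0 <= k < j.+1) k%:R * c k)).
  clear -K0 HJ c0.
  elim: j => [|j IH].
    rewrite big_nat1 expr0n mul0r mulr0 sub0r oppr_le0 mulr_ge0 ?sqr_ge0//.
    exact: ltW.
  have [jJ|jJ] := leqP j.+1 J.
    apply: (@le_trans _ _ 0); last by apply: sumr_ge0 => k _; rewrite mulr_ge0.
    rewrite subr_le0 ler_wpM2l ?(ltW K0)//.
    by rewrite -!natrX ler_nat leq_sqr.
  rewrite big_nat_recr//=.
  have /HJ := ltnW jJ; move: IH; rewrite -natr1 => IH cj.
  have j0 : 0 <= j%:R :> R by [].
  nra.
rewrite /g (big_cat_nat _ ji)//= -[leLHS]addr0 lerD//; last by apply: sumr_ge0.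
apply: ler_sum_nat => k /andP[_ kj]; rewrite /h ifT//.
by apply: leq_trans aji; rewrite leq_exp2l.
Qed.

(* Replacing the base a_k by p * a^q absorbs the polynomial distortion of the
   index. *)
Lemma log_tail_le n (lk : 'I_n -> nat -> R) l (C : R) p q :
  (forall i, 0 <= l i) -> (forall k i, 0 <= lk k i) ->
  (0 < p)%N -> (0 < q)%N -> 0 <= C ->
  (forall m, (tail l (p * m ^ q) <= C%:E * \sum_(k < n) tail (lk k) m)%E) ->
  (forall k, log_tail (lk k)) -> log_tail l.
Proof.
move=> l0 lk0 p0 q0 C0 H /(_ _)/cid2-/all_sig2[a a1 aT].
pose A := (\sum_k a k + 2)%N.
have aA k : (a k <= A)%N by rewrite /A (bigD1 k)//=; lia.
have A1 : (1 < A)%N by rewrite /A; lia.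
exists (p * A ^ q)%N.
  have : (A ^ 1 <= A ^ q)%N by rewrite leq_exp2l.
  by rewrite expn1; nia.
apply: (@le_lt_trans _ _ (\sum_(0 <= j <oo) (C%:E * \sum_(k < n) (j%:R%:E * tail (lk k) (a k ^ j))))%E).
  apply: lee_nneseries => j _.
    by move=> _; rewrite mule_ge0 ?lee_fin ?tail_ge0.
  rewrite -ge0_sume_distrr; last by move=> k _; rewrite tail_ge0.
  (* The vanishing weight at [j = 0] matters: [p <= p ^ j], needed to compare the indices, fails
     there when [p > 1]. *)
  rewrite muleCA; case: j => [|j]; first by rewrite !mul0e.
  rewrite lee_wpmul2l ?lee_fin//.
  apply: le_trans (le_trans (H (A ^ j.+1)%N) _).
    apply: tail_anti => //; rewrite expnMn -!expnM (mulnC q) leq_mul//.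
    by rewrite -[leqLHS]expn1; case: (p) p0 => [|[|p']]// _; rewrite ?exp1n// leq_exp2l.
  rewrite lee_wpmul2l ?lee_fin//; apply: lee_sum => k _; apply: tail_anti => //.
  by rewrite leq_exp2r.
rewrite nneseriesZl; last first.
  by move=> j _; apply: sume_ge0 => k _; rewrite mule_ge0 ?lee_fin ?tail_ge0.
rewrite lte_mul_pinfty ?lee_fin//.
rewrite nneseries_sum; last by move=> *; rewrite mule_ge0 ?lee_fin ?tail_ge0.
by apply: lte_sum_pinfty => k _; exact: aT.
Qed.

(** Weyl's inequality only reaches the even indices; each odd term is bounded by the even one before
    it, whence the factor 2. *)
Lemma tail_double_le l (f : nat -> R) m : (forall i, 0 <= l i) ->
  nonincreasing_seq l -> (forall i, l i.*2 <= f i) ->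
  (tail l (2 * m) <= 2%:E * tail f m)%E.
Proof.
move=> l0 dl lf.
have f0 i : 0 <= f i by apply: le_trans (lf i).
have E n : \sum_(m.*2 <= i < n.*2) l i = \sum_(m <= i < n) (l i.*2 + l i.*2.+1).
  case: (leqP n m) => nm; first by rewrite !big_geq// leq_double.
  elim: n nm => // n IH; rewrite ltnS leq_eqVlt => /predU1P[->|mn].
    by rewrite big_nat1 doubleS big_ltn// big_nat1.
  rewrite [RHS]big_nat_recr ?(ltnW mn)//= -IH// doubleS.
  have mn2 : (m.*2 <= n.*2)%N by rewrite leq_double ltnW.
  by rewrite !big_nat_recr ?leqW//= addrA.
rewrite -nneseriesZl; last by move=> i _; rewrite lee_fin.
apply: nneseries_le => [i|n]; first by rewrite lee_fin.
apply: le_trans (nneseries_lim_ge n _); last first.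
  by move=> i _ _; rewrite -EFinM lee_fin mulr_ge0.
under [leRHS]eq_bigr do rewrite -EFinM.
rewrite !sumEFin lee_fin mul2n.
apply: (@le_trans _ _ (\sum_(m.*2 <= i < n.*2) l i)).
  have [nm|mn] := leqP n m.*2; first by rewrite big_geq// sumr_ge0.
  rewrite [leRHS](big_cat_nat (ltnW mn)) ?lerDl ?sumr_ge0//; first lia.
rewrite E; apply: ler_sum => i _; have := lf i; have := dl _ _ (leqnSn i.*2); lra.
Qed.

End log_tail.

(** * Positive operators on a Hilbert space *)

Section linear_functions.
Variables (K : nzRingType) (U V : lmodType K) (f : U -> V).
Hypothesis fl : linear f.

Lemma linear_opD x y : f (x + y) = f x + f y.
Proof. by have := fl 1 x y; rewrite !scale1r. Qed.
Lemma linear_op0 : f 0 = 0. Proof. by apply: (addrI (f 0)); rewrite -linear_opD !addr0. Qed.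
Lemma linear_opZ a x : f (a *: x) = a *: f x.
Proof. by have := fl a x 0; rewrite linear_op0 !addr0. Qed.
Lemma linear_opN x : f (- x) = - f x. Proof. by rewrite -scaleN1r linear_opZ scaleN1r. Qed.
Lemma linear_op_sum (I : Type) (r : seq I) (P : pred I) (F : I -> U) :
  f (\sum_(i <- r | P i) F i) = \sum_(i <- r | P i) f (F i).
Proof. by apply: (big_morph f linear_opD linear_op0). Qed.

End linear_functions.

Section hilbert_basics.
Context {R : realType}.
Local Notation Re := (@complex.Re R).
Local Notation Im := (@complex.Im R).
Local Open Scope complex_scope.

(** The squared modulus, valued in [R] like [nsq] and [qf] below, so that every estimate is a
    polynomial inequality between reals, without square roots. *)
Definition csq (z : R[i]) : R := Re z ^+ 2 + Im z ^+ 2.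

Lemma ReD (x y : R[i]) : Re (x + y) = Re x + Re y. Proof. by case: x; case: y. Qed.
Lemma ImD (x y : R[i]) : Im (x + y) = Im x + Im y. Proof. by case: x; case: y. Qed.
Lemma ReN (x : R[i]) : Re (- x) = - Re x. Proof. by case: x. Qed.
Lemma ImN (x : R[i]) : Im (- x) = - Im x. Proof. by case: x. Qed.
Lemma ReM (x y : R[i]) : Re (x * y) = Re x * Re y - Im x * Im y. Proof. by case: x; case: y. Qed.
Lemma ImM (x y : R[i]) : Im (x * y) = Re x * Im y + Im x * Re y. Proof. by case: x; case: y. Qed.
Lemma cRe_conj (x : R[i]) : Re (Num.conj x) = Re x. Proof. by case: x. Qed.
Lemma cIm_conj (x : R[i]) : Im (Num.conj x) = - Im x. Proof. by case: x. Qed.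
Definition complexRI := (ReD, ImD, ReN, ImN, ReM, ImM, cRe_conj, cIm_conj).

Lemma complex_ext (x y : R[i]) : Re x = Re y -> Im x = Im y -> x = y.
Proof. by case: x => a b; case: y => c d /= -> ->. Qed.

Lemma Re_sum (I : Type) (r : seq I) (P : pred I) (F : I -> R[i]) :
  Re (\sum_(i <- r | P i) F i) = \sum_(i <- r | P i) Re (F i).
Proof. exact: (big_morph Re ReD erefl). Qed.

Lemma real_complex_Re (x : R[i]) : 0 <= x -> x = (Re x)%:C.
Proof. by move=> /ger0_Im; case: x => a b /= ->. Qed.

Lemma Re_ge0 (x : R[i]) : 0 <= x -> 0 <= Re x.
Proof. by move=> x0; rewrite -ler0c -real_complex_Re. Qed.

Lemma csq_ge0 z : 0 <= csq z.
Proof. by rewrite addr_ge0 ?sqr_ge0. Qed.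

Lemma csqE z : (csq z)%:C = z * Num.conj z.
Proof. by apply: complex_ext; rewrite !complexRI /= /csq; ring. Qed.

Lemma csq_eq0 z : csq z = 0 -> z = 0.
Proof.
move=> /eqP; rewrite /csq paddr_eq0 ?sqr_ge0// !sqrf_eq0 => /andP[/eqP h1 /eqP h2].
exact: complex_ext.
Qed.

Lemma csqM z w : csq (z * w) = csq z * csq w.
Proof. by rewrite /csq !complexRI; ring. Qed.

Lemma csq_conj z : csq (Num.conj z) = csq z.
Proof. by rewrite /csq !complexRI; ring. Qed.

Lemma csqN z : csq (- z) = csq z.
Proof. by rewrite /csq !complexRI; ring. Qed.

Lemma csq_real (r : R) : csq r%:C = r ^+ 2.
Proof. by rewrite /csq /=; ring. Qed.

Lemma csq0 : csq 0 = 0. Proof. by rewrite /csq /=; ring. Qed.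

Lemma csqD_le z w : csq (z + w) <= 2 * (csq z + csq w).
Proof.
rewrite /csq !complexRI; have := sqr_ge0 (Re z - Re w); have := sqr_ge0 (Im z - Im w).
nra.
Qed.

Variable H : hilbertType R.
Implicit Types (x y z : H) (A : H -> H).

Definition nsq x : R := Re (hdot x x).

Lemma hdotC x y : hdot x y = Num.conj (hdot y x).
Proof. by rewrite hermC expr0 mul1r. Qed.
Lemma hdotDl x y z : hdot (x + y) z = hdot x z + hdot y z.
Proof. exact: linearDl. Qed.
Lemma hdotDr x y z : hdot z (x + y) = hdot z x + hdot z y.
Proof. exact: linearDr. Qed.
Lemma hdotZl a x z : hdot (a *: x) z = a * hdot x z.
Proof. exact: linearZl_LR. Qed.
Lemma hdotZr a x z : hdot z (a *: x) = Num.conj a * hdot z x.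
Proof. exact: linearZr_LR. Qed.
Lemma hdotNl x z : hdot (- x) z = - hdot x z.
Proof. exact: linearNl. Qed.
Lemma hdotNr x z : hdot z (- x) = - hdot z x.
Proof. exact: linearNr. Qed.
Lemma hdot0l z : hdot 0 z = 0. Proof. exact: linear0l. Qed.
Lemma hdot0r z : hdot z 0 = 0. Proof. exact: linear0r. Qed.
Definition hdotE := (hdotDl, hdotDr, hdotNl, hdotNr, hdotZl, hdotZr).

Lemma hdot_suml (I : Type) (r : seq I) (P : pred I) (F : I -> H) z :
  hdot (\sum_(i <- r | P i) F i) z = \sum_(i <- r | P i) hdot (F i) z.
Proof. by apply: (big_morph (hdot^~ z)); [move=> x y; exact: hdotDl|exact: hdot0l]. Qed.
Lemma hdot_sumr (I : Type) (r : seq I) (P : pred I) (F : I -> H) z :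
  hdot z (\sum_(i <- r | P i) F i) = \sum_(i <- r | P i) hdot z (F i).
Proof. by apply: (big_morph (hdot z)); [move=> x y; exact: hdotDr|exact: hdot0r]. Qed.

Lemma hdot_ge0 x : 0 <= hdot x x. Proof. exact: dnorm_ge0. Qed.
Lemma hdotxx x : hdot x x = (nsq x)%:C.
Proof. exact/real_complex_Re/hdot_ge0. Qed.
Lemma nsq_ge0 x : 0 <= nsq x. Proof. exact/Re_ge0/hdot_ge0. Qed.
Lemma nsq_eq0 x : nsq x = 0 -> x = 0.
Proof. by move=> x0; apply/eqP; rewrite -(dnorm_eq0 (@hdot R H)) hdotxx x0. Qed.
Lemma nsq0 : nsq 0 = 0. Proof. by rewrite /nsq hdot0l. Qed.
Lemma nsq_gt0 x : x != 0 -> 0 < nsq x.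
Proof. by move=> /eqP x0; rewrite lt_def nsq_ge0 andbT; apply/eqP => /nsq_eq0. Qed.

Lemma nsqD x y : nsq (x + y) = nsq x + nsq y + 2 * Re (hdot x y).
Proof. by rewrite /nsq !hdotE [hdot y x]hdotC !complexRI; ring. Qed.
Lemma nsqN x : nsq (- x) = nsq x.
Proof. by rewrite /nsq !hdotE opprK. Qed.
Lemma nsqZ a x : nsq (a *: x) = csq a * nsq x.
Proof. by rewrite /nsq !hdotE hdotxx !complexRI /csq /=; ring. Qed.
Lemma nsqB_sym x y : nsq (x - y) = nsq (y - x).
Proof. by rewrite -nsqN opprB. Qed.
Lemma nsq_norm x : `|x| ^+ 2 = (nsq x)%:C.
Proof. by rewrite hdot_norm hdotxx. Qed.

Lemma nsqD_orth x y : hdot x y = 0 -> nsq (x + y) = nsq x + nsq y.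
Proof. by move=> xy; rewrite nsqD xy /= mulr0 addr0. Qed.

Lemma nsqD_le x y : nsq (x + y) <= 2 * (nsq x + nsq y).
Proof.
have := nsq_ge0 (x - y); rewrite !nsqD nsqN hdotNr complexRI; lra.
Qed.

Lemma nsqB_le x y : nsq (x - y) <= 2 * (nsq x + nsq y).
Proof. by rewrite -(nsqN y) nsqD_le. Qed.

Lemma norm_lt_nsq x (e : R) : 0 < e -> (`|x| < e%:C) = (nsq x < e ^+ 2).
Proof.
move=> e0; rewrite -ltcR -nsq_norm rmorphXn/= ltr_pXn2r// nnegrE ?normr_ge0//.
by rewrite ler0c ltW.
Qed.

(** Stated for filters because it is applied to the net of finite projections of a vector and to the
    image of an ultrafilter. *)
Lemma hilbert_complete (F : set_system H) : ProperFilter F ->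
  (forall e : R, 0 < e -> exists2 B, F B &
     forall x y, B x -> B y -> nsq (x - y) <= e) ->
  exists y, forall e : R, 0 < e -> F [set x | nsq (x - y) <= e].
Proof.
move=> FF Fc.
have : cauchy F.
  apply/cauchy_ballP => e e0.
  have [e' e'E] : exists e', e = e'%:C.
    by exists (Re e); apply: real_complex_Re; exact: ltW.
  rewrite e'E ltcR in e0 *.
  have [B FB HB] := Fc (e' ^+ 2 / 2) (divr_gt0 (exprn_gt0 _ e0) (ltr0Sn R 1)).
  exists (B, B) => //= -[x y] [/= Bx By].
  rewrite -ball_normE /= norm_lt_nsq//; apply: le_lt_trans (HB _ _ Bx By) _.
  have := exprn_gt0 2 e0; lra.
move=> /cauchy_cvg Fy; exists (lim F) => e e0.
have s0 : 0 < Num.sqrt e by rewrite sqrtr_gt0.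
have := @cvgr_dist_lt _ _ _ F FF id (lim F) Fy (Num.sqrt e)%:C.
rewrite ltcR => /(_ s0); apply: filterS => x /=.
by rewrite norm_lt_nsq// sqr_sqrtr ?(ltW e0)// nsqB_sym => /ltW.
Qed.

Lemma dense_nsq (S : set H) : dense S <->
  forall x (e : R), 0 < e -> exists2 s, S s & nsq (x - s) <= e.
Proof.
split => [dS x e e0|dS O [x Ox] oO].
  have s0 : 0 < Num.sqrt e by rewrite sqrtr_gt0.
  have e0' : 0 < (Num.sqrt e)%:C :> R[i] by rewrite ltcR.
  have [||s [/= bs Ss]] := dS (ball x (Num.sqrt e)%:C).
  - by exists x; exact: ballxx.
  - exact: ball_open.
  exists s => //; move: bs; rewrite -ball_normE /= norm_lt_nsq//.
  by rewrite sqr_sqrtr ?(ltW e0)// => /ltW.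
have /nbhs_ballP[e /= e0 He] : nbhs x O by exact: open_nbhs_nbhs.
have eE := real_complex_Re (ltW e0); rewrite eE ltcR in e0.
have [s Ss xs] := dS x (Re e ^+ 2 / 2) (divr_gt0 (exprn_gt0 _ e0) (ltr0Sn R 1)).
exists s; split => //; apply: He; rewrite eE -ball_normE /= norm_lt_nsq//.
apply: le_lt_trans xs _; have := exprn_gt0 2 e0; lra.
Qed.

Definition qf A x : R := Re (hdot (A x) x).

Section positive.
Variable A : H -> H.
Hypotheses (Al : linear A) (A0 : positive_operator A).

Lemma qf_ge0 x : 0 <= qf A x. Proof. exact/Re_ge0/A0. Qed.
Lemma hdot_qf x : hdot (A x) x = (qf A x)%:C.
Proof. exact/real_complex_Re/A0. Qed.

(* Polarization: <A z, z> is real for z = x + y and z = x + i y. *)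
Lemma hdot_selfadj x y : hdot (A x) y = hdot x (A y).
Proof.
rewrite [RHS]hdotC.
have h z : Im (hdot (A z) z) = 0 by rewrite hdot_qf.
have h1 := h (x + y); have h2 := h (x + (0 +i* 1) *: y).
rewrite !(linear_opD Al, linear_opZ Al, hdotE) !complexRI !h /= in h1 h2.
by apply: complex_ext; rewrite !complexRI; lra.
Qed.

Lemma qfD x y : qf A (x + y) = qf A x + qf A y + 2 * Re (hdot (A x) y).
Proof.
rewrite /qf !(linear_opD Al, hdotE) [hdot (A y) x]hdot_selfadj [hdot y _]hdotC !complexRI; ring.
Qed.
Lemma qfZ a x : qf A (a *: x) = csq a * qf A x.
Proof. by rewrite /qf !(linear_opZ Al, hdotE) hdot_qf !complexRI /csq /=; ring. Qed.
Lemma qf0 : qf A 0 = 0. Proof. by rewrite /qf hdot0r. Qed.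

(** The form of [A] at [x - t b y] is a nonnegative quadratic polynomial in the real [t]. Its
    minimum at [t = 1 / qf A y] gives the claim; if [qf A y = 0] it is affine, and a nonzero [b]
    would make it equal to -1 for some [t]. *)
Lemma positive_CS x y : csq (hdot (A x) y) <= qf A x * qf A y.
Proof.
set b := hdot (A x) y.
have h (t : R) : 0 <= qf A x + t ^+ 2 * csq b * qf A y - 2 * t * csq b.
  have := qf_ge0 (x + ((- t)%:C * b) *: y).
  rewrite qfD qfZ hdotZr -/b csqM csq_real.
  suff -> : Re (Num.conj ((- t)%:C * b) * b) = - t * csq b by lra.
  by rewrite !complexRI /csq /=; ring.
have [qy|qy] := eqVneq (qf A y) 0.
  rewrite qy mulr0; have [b0|b0] := eqVneq (csq b) 0; first by rewrite b0.
  have bp : 0 < csq b by rewrite lt_def b0 csq_ge0.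
  have := h ((qf A x + 1) / (2 * csq b)).
  have -> : 2 * ((qf A x + 1) / (2 * csq b)) * csq b = qf A x + 1.
    by field; rewrite gt_eqF.
  rewrite qy; lra.
have yp : 0 < qf A y by rewrite lt_def qy qf_ge0.
have := h (qf A y)^-1.
have -> : qf A x + (qf A y)^-1 ^+ 2 * csq b * qf A y - 2 * (qf A y)^-1 * csq b
  = qf A x - csq b / qf A y by field.
by rewrite subr_ge0 ler_pdivrMr.
Qed.

End positive.

Lemma CauchySchwarz_nsq x y : csq (hdot x y) <= nsq x * nsq y.
Proof. exact: (@positive_CS id (fun _ _ _ => erefl) hdot_ge0). Qed.

Lemma bounded_nsq A : bounded_operator A ->
  exists2 C : R, 0 < C & forall x, nsq (A x) <= C * nsq x.
Proof.
move=> [Al [M HM]]; pose M' := `|M| + 1.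
have [C CE] : exists C, M' = C%:C by exists (Re M'); apply: real_complex_Re; rewrite addr_ge0.
have C0 : 0 < C by rewrite -ltcR -CE ltr_wpDl.
exists (C ^+ 2); first exact: exprn_gt0.
move=> x; rewrite -lecR rmorphM rmorphXn/= -CE -!nsq_norm -exprMn.
apply: lerXn2r; rewrite ?nnegrE ?normr_ge0//; first by rewrite mulr_ge0 ?addr_ge0.
have [->|x0] := eqVneq x 0; first by rewrite (linear_op0 Al) normr0 mulr0.
have n0 : 0 < `|x| by rewrite normr_gt0.
apply: (le_trans (HM x)).
suff Mr : M <= M' by rewrite ler_wpM2r.
have MR : 0 <= M.
  have := le_trans (normr_ge0 _) (HM x); by rewrite pmulr_lge0.
by rewrite /M' ger0_norm// lerDl.
Qed.

(** Expand [nsq (A x - x) >= 0]. *)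
Lemma qf_le_nsq A (C : R) x : 0 < C -> linear A -> positive_operator A ->
  (forall x, nsq (A x) <= C * nsq x) -> qf A x <= (1 + C) * nsq x.
Proof.
move=> C0 Al A0 AC.
have := nsq_ge0 (A x - x); have := AC x.
rewrite nsqD nsqN hdotNr complexRI -/(qf A x).
have := nsq_ge0 x; have := qf_ge0 A0 x; nra.
Qed.

(** * Finite orthogonal projections and Bessel's inequality *)

Section projection.
Context {I : choiceType}.
Implicit Types (r : seq I) (f : I -> H).

(** Zero vectors are allowed, so that eigenvector families padded with zeros obey the same
    projection lemmas as orthonormal sets. *)
Definition sub_orthonormal (D : set I) f := forall i j, D i -> D j ->
  hdot (f i) (f j) = ((i == j) && (f i != 0))%:R.

Definition oproj r f x := \sum_(i <- r) hdot x (f i) *: f i.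

Lemma sub_orthonormal_nsq D f i : sub_orthonormal D f -> D i ->
  nsq (f i) = (f i != 0)%:R.
Proof. by move=> fo Di; rewrite /nsq fo// eqxx; case: (_ != _). Qed.

Lemma hdot_sub_proj r f x i : uniq r -> sub_orthonormal [set` r] f -> i \in r ->
  hdot (x - oproj r f x) (f i) = 0.
Proof.
move=> ur fo ir; rewrite hdotDl hdotNl hdot_suml (bigD1_seq i)//= big1_seq; last first.
  by move=> j /andP[ji jr]; rewrite hdotZl fo// (negPf ji) mulr0.
rewrite hdotZl fo// eqxx addr0; have [->|_] := eqVneq (f i) 0.
  by rewrite hdot0r mul0r subr0.
by rewrite mulr1 subrr.
Qed.

Lemma hdot_sub_proj0 r f x y : uniq r -> sub_orthonormal [set` r] f ->
  (exists a, y = \sum_(i <- r) a i *: f i) -> hdot (x - oproj r f x) y = 0.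
Proof.
move=> ur fo [a ->]; rewrite hdot_sumr big1_seq// => i /andP[_ ir].
by rewrite hdotZr hdot_sub_proj// mulr0.
Qed.

Lemma nsq_comb r f (a : I -> R[i]) : uniq r -> sub_orthonormal [set` r] f ->
  nsq (\sum_(i <- r) a i *: f i) = \sum_(i <- r) csq (a i) * nsq (f i).
Proof.
move=> ur fo; rewrite /nsq hdot_suml Re_sum; apply: eq_big_seq => i ir.
rewrite hdot_sumr (bigD1_seq i)//= big1_seq ?addr0; last first.
  by move=> j /andP[ji jr]; rewrite !hdotE fo// eq_sym (negPf ji) !mulr0.
rewrite !hdotE mulrA -csqE hdotxx !complexRI /=; ring.
Qed.

Lemma nsq_proj r f x : uniq r -> sub_orthonormal [set` r] f ->
  nsq (oproj r f x) = \sum_(i <- r) csq (hdot x (f i)).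
Proof.
move=> ur fo; rewrite nsq_comb//; apply: eq_big_seq => i ir.
rewrite (sub_orthonormal_nsq fo)//; have [->|_] := eqVneq (f i) 0.
  by rewrite hdot0r csq0 mul0r.
by rewrite mulr1.
Qed.

Lemma nsq_split r f x : uniq r -> sub_orthonormal [set` r] f ->
  nsq x = \sum_(i <- r) csq (hdot x (f i)) + nsq (x - oproj r f x).
Proof.
move=> ur fo; rewrite -nsq_proj// addrC -nsqD_orth ?subrK//.
by apply: hdot_sub_proj0 => //; exists (fun i => hdot x (f i)).
Qed.

Lemma bessel r f x : uniq r -> sub_orthonormal [set` r] f ->
  \sum_(i <- r) csq (hdot x (f i)) <= nsq x.
Proof. by move=> ur fo; rewrite (nsq_split x ur fo) lerDl nsq_ge0. Qed.

Lemma nsq_proj_min r f x y : uniq r -> sub_orthonormal [set` r] f ->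
  (exists a, y = \sum_(i <- r) a i *: f i) -> nsq (x - oproj r f x) <= nsq (x - y).
Proof.
move=> ur fo [a ya].
have -> : x - y = (x - oproj r f x) + (oproj r f x - y) by rewrite addrA subrK.
rewrite (@nsqD_orth (x - oproj r f x)) ?lerDl ?nsq_ge0//.
apply: hdot_sub_proj0 => //; exists (fun i => hdot x (f i) - a i).
by rewrite ya /oproj -sumrB; apply: eq_bigr => i _; rewrite scalerBl.
Qed.

End projection.

Definition orthonormal_set (E : set H) :=
  forall x y, E x -> E y -> hdot x y = (x == y)%:R.

Lemma orthonormal_sub E D : orthonormal_set E -> D `<=` E ->
  sub_orthonormal D (@id H).
Proof.
move=> Eo DE x y /DE Ex /DE Ey; rewrite Eo//.
have [xy|//] := eqVneq x y; have [x0|//] := eqVneq x 0.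
have := Eo _ _ Ex Ex; rewrite eqxx x0 hdot0l => /eqP.
by rewrite eq_sym oner_eq0.
Qed.

Lemma orthonormal_basis_set E : orthonormal_basis E -> orthonormal_set E.
Proof. by move=> [h _] x y Ex Ey; exact: h. Qed.

Lemma lspan_comb (E : set H) x : lspan E x -> exists (r : seq H) (a : H -> R[i]),
  [/\ uniq r, [set` r] `<=` E & x = \sum_(e <- r) a e *: e].
Proof.
move=> [m [c [v [vE ->]]]]; exists (undup [seq v i | i <- enum 'I_m]).
exists (fun e => \sum_(i < m | v i == e) c i); split.
- exact: undup_uniq.
- by move=> e /=; rewrite mem_undup => /mapP[i _ ->].
rewrite (eq_bigr (fun i => \sum_(e <- undup [seq v i | i <- enum 'I_m] | v i == e) c i *: e)).
  rewrite (exchange_big_dep xpredT)//=; apply: eq_bigr => e _.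
  by rewrite scaler_suml.
move=> i _; rewrite -big_filter.
rewrite (_ : [seq e <- _ | v i == e] = [:: v i]) ?big_seq1//.
rewrite (eq_filter (a2 := pred1 (v i))); last by move=> e /=; rewrite eq_sym.
apply: filter_pred1_uniq; first exact: undup_uniq.
by rewrite mem_undup; apply: map_f; rewrite mem_enum.
Qed.

Lemma comb_lspan (E : set H) (r : seq H) (a : H -> R[i]) :
  [set` r] `<=` E -> lspan E (\sum_(e <- r) a e *: e).
Proof.
move=> rE; exists (size r), (fun i => a r`_i), (fun i => r`_i); split.
  by move=> i; apply: rE => /=; exact: mem_nth.
by rewrite (big_nth 0) big_mkord.
Qed.

End hilbert_basics.
Arguments sub_orthonormal {R H I}.

(** * Sums over orthonormal bases *)

Lemma ler_sum_subset (R : numDomainType) (I : eqType) (r s : seq I) (f : I -> R) :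
  uniq r -> uniq s -> {subset r <= s} -> (forall i, 0 <= f i) ->
  \sum_(i <- r) f i <= \sum_(i <- s) f i.
Proof.
move=> ur us rs f0; rewrite [leRHS](bigID (mem r))/= -[leLHS]addr0 lerD//.
  rewrite -[leRHS]big_filter (perm_big [seq i <- s | i \in r])//=.
  apply: uniq_perm => //; first exact: filter_uniq.
  by move=> i; rewrite mem_filter; case: (boolP (i \in r)) => // /rs ->.
exact: sumr_ge0.
Qed.

Section esum_seq.
Context {R : realType} {I : choiceType}.
Implicit Types (D : set I) (a : I -> R) (r : seq I).

Lemma esum_ge_seq D a r : uniq r -> [set` r] `<=` D ->
  ((\sum_(i <- r) a i)%:E <= \esum_(i in D) (a i)%:E)%E.
Proof.
move=> ur rD; apply: esum_ge; exists [set` r]; first by split.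
by rewrite -fsbig_seq//= sumEFin.
Qed.

Lemma esum_le_seq D a (x : \bar R) :
  (forall r, uniq r -> [set` r] `<=` D -> ((\sum_(i <- r) a i)%:E <= x)%E) ->
  (\esum_(i in D) (a i)%:E <= x)%E.
Proof.
move=> H; apply: ge_ereal_sup => _ [X [Xf XD] <-].
rewrite fsbig_finite//= sumEFin; apply: H; first exact: fset_uniq.
by move=> i /=; rewrite in_fset_set// inE => /XD.
Qed.

Lemma esum_adherent D a (t e : R) : \esum_(i in D) (a i)%:E = t%:E -> 0 < e ->
  exists r, [/\ uniq r, [set` r] `<=` D & t - e < \sum_(i <- r) a i].
Proof.
move=> at_ e0.
have [|_ [X [Xf XD] <-] h] := @ub_ereal_sup_adherent _ [set (\sum_(x \in A) (a x)%:E)%E | A in fsets D] _ e0.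
  by rewrite -/(esum _ _) at_.
rewrite -/(esum _ _) at_ in h; exists (fset_set X); split.
- exact: fset_uniq.
- by move=> i /=; rewrite in_fset_set// inE => /XD.
- by move: h; rewrite fsbig_finite//= sumEFin -EFinB lte_fin.
Qed.

End esum_seq.

Lemma esum_swap (R : realType) (I J : choiceType) (D : set I) (E : set J)
    (a : I -> J -> \bar R) : (forall i j, 0 <= a i j)%E ->
  (\esum_(i in D) \esum_(j in E) a i j = \esum_(j in E) \esum_(i in D) a i j)%E.
Proof.
move=> a0; rewrite !esum_esum//.
rewrite (@reindex_esum R _ _ (E `*` D) (D `*` E) (fun p => (p.2, p.1)))//.
split => [[j i] [/= ? ?]|[j i] [j' i'] _ _ [-> ->]|[i j] [/= ? ?]] //.
by exists (j, i).
Qed.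

Lemma esum_nneseries (R : realType) (I : choiceType) (D : set I)
    (a : I -> nat -> \bar R) : (forall i j, 0 <= a i j)%E ->
  (\esum_(i in D) \sum_(0 <= j <oo) a i j =
   \sum_(0 <= j <oo) \esum_(i in D) a i j)%E.
Proof.
move=> a0; rewrite nneseries_esumT; last by move=> j; exact: esum_ge0.
rewrite -esum_swap//; apply: eq_esum => i _.
by rewrite nneseries_esumT.
Qed.

Section has_sum_esum.
Context {R : realType} {I : choiceType}.
Local Notation Re := (@complex.Re R).
Local Notation Im := (@complex.Im R).
Local Open Scope complex_scope.
Variables (D : set I) (f : I -> R[i]).
Hypothesis f0 : forall i, D i -> 0 <= f i.

Let g i := Re (if i \in D then f i else 0).

Let g0 i : 0 <= g i.
Proof. by rewrite /g; case: ifPn => //; rewrite inE => /f0/Re_ge0. Qed.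

Let partial_sumE (B : {fset I}) :
  partial_sum (patch (fun=> 0) D f) B = (\sum_(i <- B) g i)%:C :> R[i].
Proof.
have -> : partial_sum (patch (fun=> 0) D f) B =
    \sum_(i <- B) patch (fun=> 0) D f i by rewrite big_seq_fsetE.
rewrite rmorph_sum/=; apply: eq_bigr => i _.
rewrite -real_complex_Re//.
by case: ifPn => //; rewrite inE => /f0.
Qed.

Let esum_g : \esum_(i in D) (Re (f i))%:E = \esum_(i in setT) (g i)%:E.
Proof.
rewrite esum_mkcond; apply: eq_esum => i _.
by rewrite /g; case: ifP.
Qed.

Lemma esum_has_sum (t : R) : \esum_(i in D) (Re (f i))%:E = t%:E ->
  has_sum D f t%:C.
Proof.
have TF := @totally_filter I; rewrite esum_g => gt; apply/cvgrPdist_le => /= e e0.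
have eE := real_complex_Re (ltW e0); rewrite eE ltcR in e0.
have [r [ur _ tr]] := esum_adherent gt e0.
exists [fset i in r]%fset => // B /= rB.
rewrite partial_sumE -rmorphB/= eE.
have rB' : {subset r <= B} by move=> i ir; apply: (fsubsetP rB); rewrite in_fset.
have h1 := ler_sum_subset ur (fset_uniq B) rB' g0.
have h2 : \sum_(i <- B) g i <= t.
  by rewrite -lee_fin -gt; apply: esum_ge_seq => //; exact: fset_uniq.
rewrite ger0_norm ?ler0c ?subr_ge0// lecR; lra.
Qed.

(** The partial sums are real, hence so is the limit; being monotone along finite sets, they
    converge to their supremum. *)
Lemma has_sum_esum (s : R[i]) : has_sum D f s ->
  exists2 t : R, s = t%:C & \esum_(i in D) (Re (f i))%:E = t%:E.
Proof.
have TF := @totally_filter I; move=> /cvgrPdist_lt fs.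
have {}fs (e : R) : 0 < e -> exists2 X : {fset I}, True &
    forall B : {fset I}, (X `<=` B)%fset ->
      (Im s) ^+ 2 < e ^+ 2 /\ (Re s - \sum_(i <- B) g i) ^+ 2 < e ^+ 2.
  move=> e0; have e0' : 0 < e%:C :> R[i] by rewrite ltcR.
  have [X _ HX] := fs _ e0'; exists X => // B /HX /=; rewrite partial_sumE => h.
  have : csq (s - (\sum_(i <- B) g i)%:C) < e ^+ 2.
    rewrite -ltcR add_Re2_Im2 rmorphXn/= ltr_pXn2r// nnegrE ?normr_ge0//.
    exact: ltW.
  rewrite /csq !complexRI/= oppr0 addr0.
  have := sqr_ge0 (Im s); have := sqr_ge0 (Re s - \sum_(i <- B) g i).
  by split; lra.
have Im0 : Im s = 0.
  apply/eqP/negPn/negP => Is; have := normr_gt0 (Im s); rewrite Is => /fs[X _].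
  move=> /(_ X); rewrite fsubset_refl => /(_ isT)[+ _].
  by rewrite real_normK ?num_real// ltxx.
have sq_lt (x e : R) : 0 < e -> x ^+ 2 < e ^+ 2 -> - e < x < e.
  move=> e0 h; rewrite -ltr_norml; rewrite -(@ltr_pXn2r _ 2%N)// ?nnegrE ?normr_ge0 ?ltW//.
  by rewrite real_normK ?num_real.
exists (Re s); first by apply: complex_ext.
rewrite esum_g; apply/eqP; rewrite eq_le; apply/andP; split.
  apply: esum_le_seq => r ur _; rewrite lee_fin leNgt; apply/negP => sr.
  rewrite -subr_gt0 in sr; have [X _ HX] := fs _ sr.
  have [|_ /sq_lt] := HX (X `|` [fset i in r])%fset; first exact: fsubsetUl.
  have rX : {subset r <= (X `|` [fset i in r])%fset}.
    by move=> i ir; rewrite in_fsetU in_fset ir orbT.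
  by have := ler_sum_subset ur (fset_uniq _) rX g0; move=> ? /(_ sr); lra.
apply/lee_addgt0Pr => e e0; have [X _ /(_ X)] := fs _ e0.
rewrite fsubset_refl => /(_ isT)[_ /(sq_lt _ _ e0)] h.
apply: (@le_trans _ _ ((\sum_(i <- X) g i)%:E + e%:E)%E).
  by rewrite -EFinD lee_fin; lra.
by rewrite leeD2r//; apply: esum_ge_seq => //; exact: fset_uniq.
Qed.

End has_sum_esum.

(** * Existence of orthonormal bases and Parseval's identity *)

Section onb.
Context {R : realType} {H : hilbertType R}.
Implicit Types (E : set H) (x y z : H).

Lemma proj_mono E (r r' : seq H) x : orthonormal_set E -> uniq r -> uniq r' ->
  [set` r'] `<=` E -> {subset r <= r'} ->
  nsq (oproj r' id x - oproj r id x) = nsq (x - oproj r id x) - nsq (x - oproj r' id x).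
Proof.
move=> Eo ur ur' r'E rr'; have so := orthonormal_sub Eo r'E.
have -> : x - oproj r id x = (x - oproj r' id x) + (oproj r' id x - oproj r id x).
  by rewrite addrA subrK.
rewrite (@nsqD_orth _ _ (x - oproj r' id x)); first by rewrite [RHS]addrC addKr.
apply: hdot_sub_proj0 => //.
exists (fun e => (if e \in r' then hdot x e else 0) - (if e \in r then hdot x e else 0)).
have E1 (r1 : seq H) : uniq r1 -> {subset r1 <= r'} ->
    oproj r1 id x = \sum_(e <- r') (if e \in r1 then hdot x e else 0) *: e.
  move=> ur1 r1r'; rewrite [RHS](bigID (mem r1))/= addrC big1 ?add0r; last first.
    by move=> e /negPf ->; rewrite scale0r.
  rewrite -big_filter (perm_big [seq e <- r' | e \in r1])/=; last first.
    exact: perm_refl.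
  rewrite /oproj (perm_big [seq e <- r' | e \in r1])/=; last first.
    apply: uniq_perm => //; first exact: filter_uniq.
    by move=> i; rewrite mem_filter; case: (boolP (i \in r1)) => // /r1r' ->.
  by rewrite !big_filter; apply: eq_bigr => e ->.
rewrite (E1 r)// (E1 r')// -sumrB; apply: eq_bigr => e _.
by rewrite scalerBl.
Qed.

(** The projections of [x] on finite parts of [E] form a Cauchy net: by [proj_mono], they move by no
    more than the decrease of the squared distance to [x], which approaches its infimum. The limit
    [y] has [x - y] orthogonal to [E], so [x = y]. *)
Lemma onb_criterion E : orthonormal_set E ->
  (forall z, (forall e, E e -> hdot z e = 0) -> z = 0) -> orthonormal_basis E.
Proof.
move=> Eo Emax; split => //; apply/dense_nsq => x.
pose D := [set r : seq H | uniq r /\ [set` r] `<=` E].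
pose B (r : seq H) := [set oproj r' id x | r' in [set r' | D r' /\ {subset r <= r'}]].
have Dc (r1 r2 : seq H) : D r1 -> D r2 -> D (undup (r1 ++ r2)).
  move=> [_ h1] [_ h2]; split; first exact: undup_uniq.
  by move=> e /=; rewrite mem_undup mem_cat => /orP[/h1|/h2].
have FF : ProperFilter (filter_from D B).
  apply: filter_from_proper; last by move=> r Dr; exists (oproj r id x); exists r => //; split.
  apply: filter_from_filter; first by exists [::]; split.
  move=> r1 r2 D1 D2; exists (undup (r1 ++ r2)); first exact: Dc.
  move=> _ [r [Dr rr] <-]; split; exists r => //; split => // e er; apply: rr;
    by rewrite mem_undup mem_cat er ?orbT.
pose N := [set nsq (x - oproj r id x) | r in D].
have Ninf : has_inf N.
  split; first by exists (nsq (x - oproj [::] id x)), [::] => //; split.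
  by exists 0 => _ [r _ <-]; exact: nsq_ge0.
have [|y Fy] := hilbert_complete FF.
  move=> e e0; have e40 : 0 < e / 4 by lra.
  have [_ [r Dr <-] re] := inf_adherent e40 Ninf.
  have close r' : D r' -> {subset r <= r'} ->
      nsq (oproj r' id x - oproj r id x) <= e / 4.
    move=> [ur' r'E] rr'; rewrite (proj_mono _ Eo)//; last by case: Dr.
    have : inf N <= nsq (x - oproj r' id x) by apply: ge_inf; [case: Ninf|exists r'].
    by move: re; lra.
  exists (B r); first by exists r.
  move=> _ _ [r1 [D1 rr1] <-] [r2 [D2 rr2] <-].
  have -> : oproj r1 id x - oproj r2 id x =
    (oproj r1 id x - oproj r id x) - (oproj r2 id x - oproj r id x).
    by rewrite opprB addrA subrK.
  apply: le_trans (nsqB_le _ _) _.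
  have := close _ D1 rr1; have := close _ D2 rr2; lra.
have xy : x = y.
  apply/eqP; rewrite -subr_eq0; apply/eqP/Emax => e Ee; apply: csq_eq0.
  apply/eqP; rewrite eq_le csq_ge0 andbT; apply/ler_addgt0Pr => d d0; rewrite add0r.
  have [r Dr Hr] := Fy d d0.
  have De : D [:: e] by split => // ? /=; rewrite inE => /eqP ->.
  (* Enlarging [r] by [e] keeps the projection close to [y] and makes its difference with [x]
     orthogonal to [e]. *)
  have Dr' := Dc _ _ De Dr; set r' := undup _ in Dr'.
  have : nsq (oproj r' id x - y) <= d.
    by apply: Hr; exists r' => //; split => // i ir; rewrite mem_undup mem_cat ir orbT.
  have -> : hdot (x - y) e = hdot (oproj r' id x - y) e.
    rewrite -[x - y](subrK (oproj r' id x - y)) hdotDl.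
    rewrite opprB addrA subrK (@hdot_sub_proj _ _ _ _ id) ?add0r//.
    - by case: Dr'.
    - by case: Dr' => _ h; exact: orthonormal_sub Eo h.
    - by rewrite mem_undup inE eqxx.
  move=> h; apply: le_trans (CauchySchwarz_nsq _ _) _.
  by rewrite [nsq e](_ : _ = 1) ?mulr1// /nsq Eo// eqxx.
move=> e e0; have [r Dr Hr] := Fy e e0.
exists (oproj r id x); first by rewrite /oproj; apply: comb_lspan; case: Dr.
by rewrite nsqB_sym {2}xy; apply: Hr; exists r => //; split.
Qed.

Lemma dense_lspan_eq0 E z : dense (lspan E) ->
  (forall e, E e -> hdot z e = 0) -> z = 0.
Proof.
move=> /dense_nsq dE zE; apply: nsq_eq0.
apply/eqP; rewrite eq_le nsq_ge0 andbT; apply/ler_addgt0Pr => d d0; rewrite add0r.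
have [s [m [c [v [vE ->]]]] zs] := dE z d d0.
have zs0 : hdot z (\sum_i c i *: v i) = 0.
  by rewrite hdot_sumr big1// => i _; rewrite hdotZr zE ?mulr0.
by apply: le_trans zs; rewrite nsqD nsqN hdotNr zs0 oppr0 mulr0 addr0 lerDl nsq_ge0.
Qed.

(** Zorn's lemma is applied to the part [B] added to [E], not to the supersets of [E]: the union of
    an empty chain is then still admissible. *)
Lemma orthonormal_extension E : orthonormal_set E ->
  exists2 E', E `<=` E' & orthonormal_basis E'.
Proof.
move=> Eo; have [|A [Ao Amax]] := @Zorn_bigcup H (fun B => orthonormal_set (E `|` B)).
  move=> F FP Ft x y [Ex|[X FX Xx]] [Ey|[Y FY Yy]].
  - exact: Eo.
  - by apply: (FP _ FY); [left|right].
  - by apply: (FP _ FX); [right|left].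
  - have [XY|YX] := Ft _ _ FX FY.
      by apply: (FP _ FY); right => //; exact: XY.
    by apply: (FP _ FX); right => //; exact: YX.
exists (E `|` A); first exact: subsetUl.
apply: onb_criterion => // z zEA; apply/eqP/negPn/negP => z0.
have nz := nsq_gt0 z0; pose c := ((Num.sqrt (nsq z))^-1)%:C%C; pose u := c *: z.
have uu : hdot u u = 1.
  rewrite hdotxx nsqZ csq_real exprVn sqr_sqrtr ?ltW// mulVf ?gt_eqF//.
have uEA e : (E `|` A) e -> hdot u e = 0 by move=> /zEA h; rewrite hdotZl h mulr0.
have NA : ~ A u.
  by move=> Au; have := uEA u (or_intror Au); rewrite uu => /eqP; rewrite oner_eq0.
have NE : ~ E u.
  by move=> Eu; have := uEA u (or_introl Eu); rewrite uu => /eqP; rewrite oner_eq0.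
apply: (Amax (A `|` [set u])).
  by split; [exact: subsetUl|move=> /(_ u (or_intror erefl))].
rewrite setUA => x y [EAx|->] [EAy|->].
- exact: Ao.
- rewrite hdotC uEA// rmorph0; case: eqP => // xu; rewrite xu in EAx.
  by case: EAx.
- rewrite uEA//; case: eqP => // xu; rewrite -xu in EAy.
  by case: EAy.
- by rewrite eqxx.
Qed.

Lemma parseval E x : orthonormal_basis E ->
  \esum_(e in E) (csq (hdot x e))%:E = (nsq x)%:E.
Proof.
move=> Eb; have Eo := orthonormal_basis_set Eb; case: Eb => _ /dense_nsq dE.
apply/eqP; rewrite eq_le; apply/andP; split.
  apply: esum_le_seq => r ur rE; rewrite lee_fin.
  exact: (@bessel _ _ _ _ id _ ur (orthonormal_sub Eo rE)).
apply/lee_addgt0Pr => d d0; have [s /lspan_comb[r [a [ur rE sE]]] xs] := dE x d d0.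
have so := orthonormal_sub Eo rE.
rewrite (nsq_split x ur so) EFinD leeD//; first exact: esum_ge_seq.
rewrite lee_fin; apply: le_trans xs; apply: nsq_proj_min => //.
by exists a.
Qed.

Lemma csq_hdotC x y : csq (hdot x y) = csq (hdot y x).
Proof. by rewrite hdotC csq_conj. Qed.

Lemma parsevalZ E (l : R) x : orthonormal_basis E -> 0 <= l ->
  \esum_(e in E) (l * csq (hdot e x))%:E = (l * nsq x)%:E.
Proof.
move=> Eb l0; have sl : csq (Num.sqrt l)%:C%C = l by rewrite csq_real sqr_sqrtr.
rewrite -[in RHS]sl -nsqZ -(parseval _ Eb); apply: eq_esum => e _.
by rewrite hdotZl csqM sl csq_hdotC.
Qed.

End onb.

(** * The spectral theorem for positive operators of finite trace *)

Section spectral.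
Context {R : realType} {H : hilbertType R}.
Local Notation Re := (@complex.Re R).
Local Open Scope complex_scope.
Implicit Types (E : set H) (x y z : H).

(* e i = 0 where l i = 0, so that finite rank needs no separate treatment; the
   e i with l i != 0 need not span a dense subspace. *)
Record spectral_decomposition (A : H -> H) (l : nat -> R) (e : nat -> H) : Prop := {
  sd_mono : nonincreasing_seq l ;
  sd_ge0 : forall i, 0 <= l i ;
  sd_neq0 : forall i, (e i != 0) = (l i != 0) ;
  sd_orth : sub_orthonormal setT e ;
  sd_eigen : forall i, A (e i) = (l i)%:C *: e i ;
  sd_max : forall m x, (forall i, (i < m)%N -> hdot x (e i) = 0) ->
    qf A x <= l m * nsq x }.

Section construction.
Variable A : H -> H.
Hypotheses (Ab : bounded_operator A) (A0 : positive_operator A).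
Let Al : linear A := proj1 Ab.
Variables (E : set H) (T : R).
Hypotheses (Eb : orthonormal_basis E)
  (AT : \esum_(e in E) (qf A e)%:E = T%:E).

(** A single ultrafilter makes all bounded coordinates converge at once, in place of a diagonal
    extraction of subsequences. *)
Lemma ultra_cvg_real (U : set_system H) (h : H -> R) (M : R) : UltraFilter U ->
  U [set x | `|h x| <= M] -> exists c, forall e, 0 < e -> U [set x | `|h x - c| <= e].
Proof.
move=> UU UM.
have : compact `[- M, M]%classic by exact: segment_compact.
rewrite compact_ultra => /(_ (h @ U) _) [].
  have PU : ProperFilter (h @ U) by exact: fmap_proper_filter.
  split => // G PG UG; apply/seteqP; split => // B GB.
  have [//|UC] := in_ultra_setVsetC (h @^-1` B) UU.
  have : G (B `&` ~` B) by apply: filterI => //; exact: UG.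
  by rewrite setICr => /filter_not_empty.
- have : U (h @^-1` `[- M, M]%classic); last by [].
  by apply: filterS UM => x /=; rewrite in_itv/= -ler_norml.
move=> c [_ /= hc]; exists c => e e0.
by move/cvgrPdist_le : hc => /(_ e e0); apply: filterS => x /=; rewrite distrC.
Qed.

Lemma ultra_cvg_complex (U : set_system H) (h : H -> R[i]) (M : R) : UltraFilter U ->
  U [set x | csq (h x) <= M] -> exists c, forall e, 0 < e -> U [set x | csq (h x - c) <= e].
Proof.
move=> UU UM.
have le_sqr (a b : R) : a ^+ 2 + b ^+ 2 <= M -> `|a| <= M + 1.
  move=> h2; rewrite ler_norml; have := sqr_ge0 b.
  have := sqr_ge0 (a - 1); have := sqr_ge0 (a + 1); have := sqr_ge0 a; nra.
have [|c1 h1] := @ultra_cvg_real U (Re \o h) (M + 1) UU.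
  by apply: filterS UM => x /= /le_sqr.
have [|c2 h2] := @ultra_cvg_real U (@complex.Im R \o h) (M + 1) UU.
  by apply: filterS UM => x /=; rewrite /csq addrC => /le_sqr.
exists (c1 +i* c2) => e e0.
have s0 : 0 < Num.sqrt (e / 2) by rewrite sqrtr_gt0 divr_gt0.
have sq (a : R) : `|a| <= Num.sqrt (e / 2) -> a ^+ 2 <= e / 2.
  move=> ha; rewrite -[e / 2]sqr_sqrtr ?divr_ge0 ?(ltW e0)// -[a ^+ 2]real_normK ?num_real//.
  by rewrite ler_pXn2r// nnegrE ?normr_ge0 ?sqrtr_ge0.
apply: filterS (filterI (h1 _ s0) (h2 _ s0)) => x /= [/sq k1 /sq k2].
by rewrite /csq !complexRI /=; lra.
Qed.

(* Off a finite part F of the basis, csq <A x, e> <= qf A x * qf A e, which has a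
   small sum, so A maps the unit ball into a totally bounded set. *)
Lemma compact_ultra_cvg (U : set_system H) : UltraFilter U ->
  U [set x | nsq x <= 1] -> exists y, forall e, 0 < e -> U [set x | nsq (A x - y) <= e].
Proof.
move=> UU U1; have [C C0 AC] := bounded_nsq Ab.
have Eo := orthonormal_basis_set Eb.
have [|y Hy] := @hilbert_complete _ _ (A @ U) _; last by exists y.
move=> d d0.
(* [K] bounds [qf A w] for a difference [w] of two vectors of the unit ball, as [nsq w <= 4]; the
   trace left outside [F] is below [d / (2 K)]. *)
pose K := 4 * (1 + C); have K0 : 0 < K by rewrite /K; lra.
have [F [uF FE TF]] := esum_adherent AT (divr_gt0 d0 (mulr_gt0 (ltr0Sn R 1) K0)).
have qE x : qf A x <= (1 + C) * nsq x by exact: qf_le_nsq.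
have coord e : E e -> exists c, forall t, 0 < t -> U [set x | csq (hdot (A x) e - c) <= t].
  move=> Ee; apply: (@ultra_cvg_complex U (fun x => hdot (A x) e) C) => //.
  apply: filterS U1 => x /= x1; apply: le_trans (CauchySchwarz_nsq _ _) _.
  rewrite [nsq e](_ : _ = 1) ?mulr1; last by rewrite /nsq Eo// eqxx.
  apply: (le_trans (AC x)); nra.
have /choice[c Hc] : forall e, exists c, E e -> forall t, 0 < t ->
    U [set x | csq (hdot (A x) e - c) <= t].
  move=> e; have [Ee|nEe] := pselect (E e); last by exists 0.
  by have [c Hc] := coord e Ee; exists c.
(* Each coordinate of [F] costs at most [4 t] for a difference of two vectors, hence [d / 2] in all;
   the successor avoids a division by 0. *)
pose t := d / (8 * (size F).+1%:R).
have t0 : 0 < t by rewrite divr_gt0// mulr_gt0.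
have US (s : seq H) : [set` s] `<=` E ->
    U [set x | forall e, e \in s -> csq (hdot (A x) e - c e) <= t].
  elim: s => [|a s IH] sE; first by apply: filterS filterT => x _ e.
  have Ea : E a by apply: sE; rewrite /= inE eqxx.
  have sE' : [set` s] `<=` E by move=> e /= es; apply: sE; rewrite /= inE es orbT.
  apply: filterS (filterI (Hc a Ea t t0) (IH sE')) => x /= [ha hs] e.
  by rewrite inE => /predU1P[->//|/hs].
pose S := [set x | nsq x <= 1 /\ forall e, e \in F -> csq (hdot (A x) e - c e) <= t].
exists (A @` S).
  have : U (A @^-1` (A @` S)); last by [].
  by apply: filterS (filterI U1 (US F FE)) => x [x1 xF]; exists x.
move=> _ _ [x [x1 xF] <-] [y [y1 yF] <-].
rewrite -(linear_opN Al) -(linear_opD Al); set w := x - y.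
have w4 : nsq w <= 4 by have := nsqB_le x y; rewrite -/w; lra.
rewrite -lee_fin -(parseval (A w) Eb) (esumID [set` F]); last first.
  by move=> e _; rewrite lee_fin csq_ge0.
rewrite (_ : d = d / 2 + d / 2); last lra.
rewrite EFinD leeD//.
  rewrite (_ : E `&` [set` F] = [set` F]); last first.
    by apply/seteqP; split => [e []//|e eF]; split => //; exact: FE.
  apply: esum_le_seq => r ur rF; rewrite lee_fin.
  have rF' : {subset r <= F} by move=> e er; exact: rF.
  apply: (@le_trans _ _ (\sum_(e <- r) 4 * t)).
    rewrite big_seq [leRHS]big_seq; apply: ler_sum => e /rF' eF.
    rewrite (linear_opD Al) (linear_opN Al) hdotDl hdotNl.
    rewrite (_ : _ - _ = (hdot (A x) e - c e) + - (hdot (A y) e - c e)); last by ring.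
    apply: le_trans (csqD_le _ _) _; rewrite csqN.
    have := xF e eF; have := yF e eF; lra.
  rewrite (_ : \sum_(e <- r) 4 * t = (size r)%:R * (4 * t)); last first.
    by rewrite big_const_seq count_predT iter_addr_0 [RHS]mulr_natl.
  apply: (@le_trans _ _ ((size F).+1%:R * (4 * t))).
    apply: ler_wpM2r; first by rewrite mulr_ge0 ?(ltW t0).
    by rewrite ler_nat leqW//; exact: uniq_leq_size.
  rewrite /t (_ : _ * _ = d / 2)//; field; by rewrite gt_eqF// ltr0n.
apply: esum_le_seq => r ur rF; rewrite lee_fin.
apply: (@le_trans _ _ (\sum_(e <- r) qf A w * qf A e)).
  by apply: ler_sum => e _; exact: positive_CS.
rewrite -mulr_sumr.
have rT : \sum_(e <- r) qf A e <= d / (2 * K).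
  have : \sum_(e <- F ++ r) qf A e <= T.
    rewrite -lee_fin -AT; apply: esum_ge_seq.
      rewrite cat_uniq uF ur andbT/=; apply/hasPn => e /= /rF[_ /= eF].
      exact/negP.
    by move=> e /=; rewrite mem_cat => /orP[/FE|/rF[]].
  rewrite big_cat/=; lra.
have qw : qf A w <= K by apply: (le_trans (qE w)); rewrite /K; nra.
apply: (@le_trans _ _ (K * (d / (2 * K)))).
  apply: ler_pM => //; first exact: qf_ge0.
  by apply: sumr_ge0 => e _; exact: qf_ge0.
rewrite (_ : _ * _ = d / 2)//; field; by rewrite gt_eqF.
Qed.

(** The inequality [A^2 <= M A] on a subspace, obtained from [positive_CS] at [x] and [A x] instead
    of a square root of [A]. *)
Lemma positive_sqr_le (V : set H) (M : R) x : (forall y, V y -> qf A y <= M * nsq y) ->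
  0 <= M -> V x -> V (A x) -> nsq (A x) <= M * qf A x.
Proof.
move=> VM M0 Vx VAx; have [->|n0] := eqVneq (nsq (A x)) 0.
  by rewrite mulr_ge0 ?qf_ge0.
have np : 0 < nsq (A x) by rewrite lt_def n0 nsq_ge0.
have := positive_CS Al A0 x (A x); rewrite hdotxx csq_real => h.
have h2 := VM _ VAx; have q0 := qf_ge0 A0 x.
rewrite -(ler_pM2r np) -expr2; apply: (le_trans h); nra.
Qed.

(** Maximize the form of [A] on the unit ball of the orthogonal complement [V] of [s], which [A]
    preserves because [s] consists of eigenvectors. An ultrafilter of almost maximizing vectors
    converges, by compactness of [A], to an eigenvector for the supremum [M]. *)
Lemma max_eigenvector (s : seq H) :
  (forall v, v \in s -> exists a, A v = a *: v) ->
  exists e l, [/\ 0 <= l, nsq e = (l != 0)%:R, A e = l%:C *: e,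
    (forall v, v \in s -> hdot e v = 0) &
    forall x, (forall v, v \in s -> hdot x v = 0) -> qf A x <= l * nsq x].
Proof.
move=> sA; pose V := [set x : H | forall v, v \in s -> hdot x v = 0].
have VA x : V x -> V (A x).
  move=> Vx v vs; rewrite hdot_selfadj//; have [a ->] := sA v vs.
  by rewrite hdotZr (Vx v vs) mulr0.
have VZ a x : V x -> V (a *: x) by move=> Vx v vs; rewrite hdotZl Vx ?mulr0.
have [C C0 AC] := bounded_nsq Ab.
have qE x : qf A x <= (1 + C) * nsq x by exact: qf_le_nsq.
pose Q := [set qf A x | x in [set x | V x /\ nsq x <= 1]].
have Q0 : Q 0.
  by exists 0; [split; [move=> v _; exact: hdot0l|rewrite nsq0]|rewrite qf0].
have supQ : has_sup Q.
  split; first by exists 0.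
  exists (1 + C) => _ [x [_ x1] <-]; apply: (le_trans (qE x)); nra.
pose M := sup Q.
have M0 : 0 <= M by apply: sup_ubound => //; case: supQ.
have VM x : V x -> qf A x <= M * nsq x.
  move=> Vx; have [x0|x0] := eqVneq x 0; first by rewrite x0 qf0 nsq0 mulr0.
  have nx := nsq_gt0 x0.
  have cn : csq ((Num.sqrt (nsq x))^-1)%:C = (nsq x)^-1.
    by rewrite csq_real exprVn sqr_sqrtr// ltW.
  rewrite -ler_pdivrMr// mulrC -cn -qfZ//.
  apply: sup_ubound; first by case: supQ.
  exists (((Num.sqrt (nsq x))^-1)%:C *: x) => //; split; first exact: VZ.
  by rewrite nsqZ cn mulVf// gt_eqF.
(* Nothing is left to diagonalize: the zero vector is the padding used from here on. *)
have [M00|Mn0] := eqVneq M 0.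
  exists 0, 0; split => //.
  - by rewrite nsq0 eqxx.
  - by rewrite (linear_op0 Al) scaler0.
  - by move=> v _; rewrite hdot0l.
  - by rewrite -M00.
have Mp : 0 < M by rewrite lt_def Mn0.
pose B (d : R) := [set x | [/\ V x, nsq x <= 1 & M - d <= qf A x]].
have FF : ProperFilter (filter_from [set d : R | 0 < d] B).
  apply: filter_from_proper; last first.
    move=> d /= d0; have [_ [x [Vx x1] <-] h] := sup_adherent d0 supQ.
    by exists x; split => //; exact: ltW.
  apply: filter_from_filter; first by exists 1 => /=.
  move=> d1 d2 /= d10 d20; exists (Num.min d1 d2) => /=; first by rewrite lt_min d10.
  move=> x [Vx x1 h]; have := ge_min (Num.min d1 d2) d1 d2.
  rewrite lexx => /esym/orP hm.
  have m1 : Num.min d1 d2 <= d1 by rewrite ge_min lexx.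
  have m2 : Num.min d1 d2 <= d2 by rewrite ge_min lexx orbT.
  by split; split => //; lra.
have [U [UU FU]] := ultraFilterLemma FF.
have UB d : 0 < d -> U (B d) by move=> d0; apply: FU; exists d.
have [|y Uy] := @compact_ultra_cvg U UU.
  by apply: filterS (UB 1 ltr01) => x [].
pose w := (M^-1)%:C *: y.
have yw : y = M%:C *: w by rewrite scalerA -rmorphM/= mulfV// scale1r.
(* [nsq (A x - M x) <= M (M - qf A x)], so almost maximizing vectors are almost eigenvectors; since
   [A x] tends to [y], [x] itself tends to [y / M]. *)
have Uw d : 0 < d -> U [set x | nsq (x - w) <= d].
  move=> d0; pose d' := d * M ^+ 2 / 4.
  have d'0 : 0 < d' by rewrite /d' !mulr_gt0// ?invr_gt0// exprn_gt0.
  apply: filterS (filterI (Uy d' d'0) (UB (d' / M) (divr_gt0 d'0 Mp))) => x [/= h [Vx x1 hq]].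
  have hA := positive_sqr_le VM M0 Vx (VA _ Vx).
  have hd : nsq (A x - M%:C *: x) <= d'.
    rewrite nsqD nsqN nsqZ csq_real hdotNr hdotZr !complexRI/= oppr0 mul0r subr0 -/(qf A x).
    have : M * (M - d' / M) <= M * qf A x by rewrite ler_wpM2l.
    rewrite mulrBr mulrCA divff// mulr1; nra.
  have : nsq (M%:C *: (x - w)) <= 4 * d'.
    rewrite scalerBr -yw (_ : _ - y = (A x - y) - (A x - M%:C *: x)).
      by apply: le_trans (nsqB_le _ _) _; lra.
    by rewrite opprB [RHS]addrC addrA subrK.
  rewrite nsqZ csq_real => h4.
  have M2 : 0 < M ^+ 2 by exact: exprn_gt0.
  by rewrite -(ler_pM2l M2); apply: le_trans h4 _; rewrite /d'; lra.
have small (r : R) : (forall d, 0 < d -> r <= d) -> r <= 0.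
  by move=> h; apply/ler_addgt0Pr => d d0; rewrite add0r h.
have Vw : V w.
  move=> v vs; apply: csq_eq0; apply/eqP; rewrite eq_le csq_ge0 andbT.
  apply: small => d d0; pose N := nsq v + 1.
  have N0 : 0 < N by rewrite ltr_wpDl ?nsq_ge0.
  have [x [/= xw [Vx _ _]]] := filter_ex (filterI (Uw _ (divr_gt0 d0 N0)) (UB 1 ltr01)).
  have -> : hdot w v = hdot (w - x) v by rewrite hdotDl hdotNl (Vx v vs) subr0.
  apply: le_trans (CauchySchwarz_nsq _ _) _; rewrite nsqB_sym.
  apply: (@le_trans _ _ (d / N * N)); last by rewrite divfK// gt_eqF.
  by apply: ler_pM => //; rewrite ?nsq_ge0// /N lerDl.
have Aw : A w = M%:C *: w.
  apply/eqP; rewrite -subr_eq0 -yw; apply/eqP/nsq_eq0/eqP; rewrite eq_le nsq_ge0 andbT.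
  apply: small => d d0; have d4 : 0 < d / 4 by lra.
  have [x [/= xw xy]] := filter_ex (filterI (Uw _ (divr_gt0 d4 C0)) (Uy _ d4)).
  rewrite (_ : _ - y = (A x - y) - (A (x - w))); last first.
    by rewrite (linear_opD Al) (linear_opN Al) opprB [RHS]addrC addrA subrK.
  apply: le_trans (nsqB_le _ _) _.
  have : nsq (A (x - w)) <= d / 4.
    apply: (le_trans (AC _)); apply: (@le_trans _ _ (C * (d / 4 / C))).
      by rewrite ler_wpM2l ?(ltW C0).
    by rewrite mulrC divfK// gt_eqF.
  lra.
(* Near [w = 0] one would have [qf A x <= M / 4], against [qf A x >= M / 2] for an almost maximizing
   [x]. *)
have w0 : w != 0.
  apply/negP => /eqP w0; have M4 : 0 < M / 2 by lra.
  have q14 : 0 < 4^-1 :> R by rewrite invr_gt0.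
  have [x [/= xw [Vx x1 hx]]] := filter_ex (filterI (Uw _ q14) (UB _ M4)).
  by move: xw; rewrite w0 subr0; have := VM x Vx; nra.
have nw := nsq_gt0 w0.
have cn : csq ((Num.sqrt (nsq w))^-1)%:C = (nsq w)^-1.
  by rewrite csq_real exprVn sqr_sqrtr// ltW.
exists (((Num.sqrt (nsq w))^-1)%:C *: w), M; split => //.
- by rewrite nsqZ cn mulVf ?gt_eqF// Mn0.
- by rewrite (linear_opZ Al) Aw scalerA [RHS]scalerA mulrC.
- exact: VZ.
Qed.

Lemma sd_qf_split l e n x : spectral_decomposition A l e ->
  qf A x = \sum_(0 <= i < n) l i * csq (hdot x (e i)) +
           qf A (x - oproj (iota 0 n) e x).
Proof.
move=> sd; have eo' : sub_orthonormal [set` iota 0 n] e.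
  by move=> i j _ _; exact: (sd_orth sd).
set p := oproj (iota 0 n) e x.
have Ap : A p = \sum_(i <- iota 0 n) ((l i)%:C * hdot x (e i)) *: e i.
  rewrite /p /oproj (linear_op_sum Al); apply: eq_bigr => i _.
  by rewrite (linear_opZ Al) (sd_eigen sd) scalerA mulrC.
have xp : hdot (A p) (x - p) = 0.
  rewrite hdotC hdot_sub_proj0 ?rmorph0 ?iota_uniq//.
  by exists (fun i => (l i)%:C * hdot x (e i)).
have := qfD Al A0 p (x - p); rewrite (addrC p) subrK xp /= mulr0 addr0 => ->.
congr (_ + _); rewrite /qf Ap hdot_suml Re_sum; rewrite /index_iota subn0.
apply: eq_big_seq => i ir; rewrite hdotZl.
have -> : hdot (e i) p = Num.conj (hdot x (e i)).
  rewrite hdotC; congr Num.conj; apply/eqP; rewrite eq_sym -subr_eq0 -hdotNl -hdotDl.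
  by rewrite hdot_sub_proj// iota_uniq.
by rewrite -mulrA -csqE -rmorphM.
Qed.

(** Iterates [max_eigenvector] on the list of the vectors already found. Only an upper bound of the
    sum of the eigenvalues is obtained here; it makes the eigenvalues small, from which equality
    follows in [sd_trace]. *)
Lemma spectral_theorem : exists l e, spectral_decomposition A l e /\ (tail l 0 <= T%:E)%E.
Proof.
(* The premise inside [P] makes the choice total on lists; lists with a vector that is no
   eigenvector get a dummy value. *)
pose P (s : seq H) (p : H * R) := (forall v, v \in s -> exists a, A v = a *: v) ->
  [/\ 0 <= p.2, nsq p.1 = (p.2 != 0)%:R, A p.1 = p.2%:C *: p.1,
    (forall v, v \in s -> hdot p.1 v = 0) &
    forall x, (forall v, v \in s -> hdot x v = 0) -> qf A x <= p.2 * nsq x].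
have /choice[step Hstep] : forall s, exists p, P s p.
  move=> s; have [/max_eigenvector[e [l h]]|h] :=
    pselect (forall v, v \in s -> exists a, A v = a *: v); first by exists (e, l).
  by exists (0, 0).
pose f := fix f n := if n is m.+1 then rcons (f m) (step (f m)).1 else [::].
pose e n := (step (f n)).1; pose l n := (step (f n)).2.
have fP n v : v \in f n -> exists2 i, (i < n)%N & v = e i.
  elim: n => [//|n IH]; rewrite mem_rcons inE => /predU1P[->|/IH[i ni ->]].
    by exists n.
  by exists i => //; exact: leqW.
have ef n i : (i < n)%N -> e i \in f n.
  elim: n => [//|n IH]; rewrite ltnS leq_eqVlt mem_rcons inE => /predU1P[->|/IH ->].
    by rewrite eqxx.
  by rewrite orbT.
have He n : [/\ 0 <= l n, nsq (e n) = (l n != 0)%:R, A (e n) = (l n)%:C *: e n,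
    (forall i, (i < n)%N -> hdot (e n) (e i) = 0) &
    forall x, (forall i, (i < n)%N -> hdot x (e i) = 0) -> qf A x <= l n * nsq x].
  elim/ltn_ind: n => n IH.
  have [|h1 h2 h3 h4 h5] := Hstep (f n).
    move=> v /fP[i /IH[_ _ Ai _ _] ->].
    by exists (l i)%:C.
  split => //.
    by move=> i ni; exact/h4/ef.
  move=> x hx; by apply: h5 => v /fP[i /hx h ->].
have l0 i : 0 <= l i by case: (He i).
have en0 i : (e i != 0) = (l i != 0).
  case: (He i) => _ + _ _ _; case: (l i != 0) => h.
    by apply/eqP => e0; move: h; rewrite e0 nsq0 => /eqP; rewrite eq_sym oner_eq0.
  by rewrite (nsq_eq0 h) eqxx.
have eo : sub_orthonormal setT e.
  move=> i j _ _; have [<-|] := eqVneq i j.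
    by rewrite en0 hdotxx; case: (He i) => _ -> _ _ _; case: (_ != _).
  rewrite neq_ltn => /orP[ij|ji].
    by rewrite hdotC; case: (He j) => _ _ _ -> //; rewrite rmorph0.
  by case: (He i) => _ _ _ ->.
have sd : spectral_decomposition A l e.
  split => //.
  (* The vector [e n.+1] already competes at stage [n], where its form value is [l n.+1]. *)
  - apply/nonincreasing_seqP => n; have [->//|ln0] := eqVneq (l n.+1) 0.
    case: (He n.+1) => _ h2 h3 h4 _; rewrite ln0 in h2; case: (He n) => _ _ _ _ h5.
    have := h5 (e n.+1) (fun i ni => h4 i (leqW ni)).
    by rewrite h2 mulr1 /qf h3 hdotZl hdotxx h2 mulr1.
  - by move=> i; case: (He i).
  - by move=> m x hx; case: (He m) => _ _ _ _; apply.
exists l, e; split => //.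
apply: nneseries_le => [i|n]; first by rewrite lee_fin.
rewrite sumEFin -AT.
have part x : \sum_(0 <= i < n) l i * csq (hdot x (e i)) <= qf A x.
  by rewrite (sd_qf_split n x sd) lerDl qf_ge0.
apply: (@le_trans _ _ (\esum_(x in E) (\sum_(0 <= i < n) l i * csq (hdot x (e i)))%:E)); last first.
  by apply: le_esum => x _; rewrite lee_fin.
under eq_esum do rewrite -sumEFin.
rewrite esum_sum; last by move=> *; rewrite lee_fin mulr_ge0// csq_ge0.
rewrite -sumEFin; apply: lee_sum => i _.
rewrite parsevalZ// lee_fin; case: (He i) => _ -> _ _ _.
by case: eqP => [->|_]; rewrite ?mulr1// mul0r.
Qed.

End construction.
End spectral.

(** * Variational principles *)

Lemma exists_left_kernel (F : fieldType) m n (M : 'M[F]_(m, n)) :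
  (n < m)%N -> exists2 r : 'rV_m, r != 0 & r *m M = 0.
Proof.
move=> nm; have : (0 < \rank (kermx M))%N.
  by rewrite mxrank_ker subn_gt0 (leq_ltn_trans (rank_leq_col M)).
rewrite lt0n mxrank_eq0 => /rowV0Pn[r /sub_kermxP rM r0].
by exists r.
Qed.

Section spectral_consequences.
Context {R : realType} {H : hilbertType R}.
Local Notation Re := (@complex.Re R).
Local Open Scope complex_scope.
Implicit Types (E : set H) (x y z : H) (A : H -> H).

Lemma lin_indep_le m n (v : 'I_m -> H) (w : 'I_n -> H) : lin_indep v ->
  (forall i, lspan (range w) (v i)) -> (m <= n)%N.
Proof.
move=> vi vw; have /choice[a aE] : forall i, exists a : 'I_n -> R[i], v i = \sum_j a j *: w j.
  move=> i; have [k [c [u [uw ->]]]] := vw i.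
  have /choice[f fE] : forall p, exists j, w j = u p by move=> p; have [j _ <-] := uw p; exists j.
  exists (fun j => \sum_(p | f p == j) c p).
  under [RHS]eq_bigr do rewrite scaler_suml.
  rewrite (exchange_big_dep xpredT)//=; apply: eq_bigr => p _.
  by rewrite (big_pred1 (f p)) ?fE// => j; rewrite eq_sym.
rewrite leqNgt; apply/negP => nm.
have [r r0 rM] := exists_left_kernel (\matrix_(i, j) a i j) nm.
have r00 : forall i, r 0 i = 0.
  apply: vi; under eq_bigr do rewrite aE scaler_sumr.
  rewrite exchange_big big1//= => j _.
  have := congr1 (fun M : 'rV_n => M 0 j) rM; rewrite !mxE => h.
  under eq_bigr do rewrite scalerA.
  rewrite -scaler_suml (_ : \sum_i _ = 0) ?scale0r//.
  by apply: etrans h; apply: eq_bigr => i _; rewrite mxE.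
by move/eqP: r0; apply; apply/rowP => i; rewrite mxE r00.
Qed.

Lemma lspan_sub (V : set H) x : V x -> lspan V x.
Proof.
move=> Vx; exists 1%N, (fun=> 1), (fun=> x); split => //.
by rewrite big_ord1 scale1r.
Qed.

Lemma has_dim_unique (V : set H) m n : has_dim V m -> has_dim V n -> m = n.
Proof.
move=> [v vi Vv] [w wi Vw]; apply/eqP; rewrite eqn_leq; apply/andP; split.
  apply: (@lin_indep_le _ _ v w vi) => i.
  by rewrite -Vw Vv; apply: lspan_sub; exists i.
apply: (@lin_indep_le _ _ w v wi) => i.
by rewrite -Vv Vw; apply: lspan_sub; exists i.
Qed.

(** At the first index [k] where the sequences differ, let [t] be the larger value. The smaller
    sequence takes the value [t] only before [k], where both agree, while the other takes it at [k]
    as well: the multiplicities of [t] differ. Since [t > 0], both are the dimension of the same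
    eigenspace. *)
Lemma eigenvalue_sequence_unique A l l' :
  eigenvalue_sequence A l -> eigenvalue_sequence A l' -> l = l'.
Proof.
move=> El El'; apply/funext => i.
have H1 (l1 l2 : nat -> R) k : eigenvalue_sequence A l1 -> eigenvalue_sequence A l2 ->
    (forall j, (j < k)%N -> l1 j = l2 j) -> l1 k < l2 k -> False.
  move=> [d1 n1 E1] [d2 n2 E2] IH lt12; set t := l2 k.
  have t0 : 0 < t by exact: le_lt_trans lt12.
  have [m1 h1 c1] := E1 t t0; have [m2 h2 c2] := E2 t t0.
  have m12 := has_dim_unique h1 h2.
  have f1 : finite_set [set i | l1 i = t] by apply/finite_setP; exists m1.
  have f2 : finite_set [set i | l2 i = t] by apply/finite_setP; exists m2.
  have j1 j : l1 j = t -> (j < k)%N.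
    move=> l1j; rewrite ltnNge; apply/negP => kj.
    by have := d1 _ _ kj; rewrite l1j leNgt lt12.
  have : (#|` fset_set [set i | l1 i = t]| < #|` fset_set [set i | l2 i = t]|)%N.
    apply: fproper_ltn_card; apply/andP; split.
      apply/fsubsetP => j; rewrite !in_fset_set// !inE /= => l1j.
      by rewrite -IH// j1.
    apply/negP => /fsubsetP/(_ k); rewrite !in_fset_set// !inE/=.
    by move=> /(_ erefl)/j1; rewrite ltnn.
  by rewrite (card_fset_set c1) (card_fset_set c2) m12 ltnn.
elim/ltn_ind: i => i IH; have [lt|lt|//] := ltgtP (l i) (l' i).
  by case: (H1 l l' i).
by case: (H1 l' l i) => // j /IH.
Qed.

Section decomposition.
Variables (A : H -> H) (l : nat -> R) (e : nat -> H).
Hypotheses (Ab : bounded_operator A) (A0 : positive_operator A).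
Hypotheses (sd : spectral_decomposition A l e) (lfin : (tail l 0 < +oo)%E).
Let Al : linear A := proj1 Ab.
Let l0 := sd_ge0 sd.

Lemma sd_nsq i : nsq (e i) = (l i != 0)%:R.
Proof. by rewrite (sub_orthonormal_nsq (sd_orth sd))// (sd_neq0 sd). Qed.

Lemma sd_nsq_le1 i : nsq (e i) <= 1.
Proof. by rewrite sd_nsq; case: (_ != _). Qed.

Lemma sd_small (d : R) : 0 < d -> exists n, l n < d.
Proof.
move=> d0; apply/not_existsP => ln.
have ld i : d <= l i by rewrite leNgt; apply/negP/ln.
have tf : tail l 0 \is a fin_num by rewrite ge0_fin_numE ?tail_ge0.
have tr := fineK tf; set t := fine _ in tr.
pose N := (Num.truncn (t / d)).+1.
have : ((\sum_(0 <= i < N) d)%:E <= tail l 0)%E.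
  apply: (@le_trans _ _ (\sum_(0 <= i < N) (l i)%:E)%E).
    by rewrite sumEFin lee_fin; apply: ler_sum.
  by apply: nneseries_lim_ge => i _ _; rewrite lee_fin.
rewrite -tr lee_fin sumr_const_nat subn0 -mulr_natl -ler_pdivlMr// leNgt.
by rewrite truncnS_gt.
Qed.

(** The remainder of [sd_qf_split] is at most [l n * nsq x], by [sd_max], and [l n] becomes
    arbitrarily small. *)
Lemma sd_qf x : (\sum_(0 <= i <oo) (l i * csq (hdot x (e i)))%:E = (qf A x)%:E)%E.
Proof.
have t0 i : (0 <= (l i * csq (hdot x (e i)))%:E)%E by rewrite lee_fin mulr_ge0 ?csq_ge0.
apply/eqP; rewrite eq_le; apply/andP; split.
  apply: nneseries_le => // n.
  by rewrite sumEFin lee_fin (sd_qf_split Ab A0 n x sd) lerDl qf_ge0.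
apply/lee_addgt0Pr => d d0; have n0 : 0 < nsq x + 1 by rewrite ltr_wpDl ?nsq_ge0.
have [n ln] := sd_small (divr_gt0 d0 n0).
have eo' : sub_orthonormal [set` iota 0 n] e by move=> i j _ _; exact: (sd_orth sd).
rewrite (sd_qf_split Ab A0 n x sd) EFinD leeD//.
  by rewrite -sumEFin; apply: nneseries_lim_ge.
rewrite lee_fin; apply: (@le_trans _ _ (l n * nsq (x - oproj (iota 0 n) e x))).
  by apply: (sd_max sd) => i ni; rewrite hdot_sub_proj ?iota_uniq// mem_iota.
apply: (@le_trans _ _ (d / (nsq x + 1) * (nsq x + 1))); last by rewrite divfK ?gt_eqF.
apply: ler_pM => //; rewrite ?nsq_ge0 ?(ltW ln)//.
rewrite (nsq_split x (iota_uniq 0 n) eo') -addrA ler_wpDl ?lerDl//.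
by apply: sumr_ge0 => i _; exact: csq_ge0.
Qed.

(** Exchange the sums and apply Parseval to each eigenvector; in particular the trace does not
    depend on the basis. *)
Lemma sd_trace E : orthonormal_basis E -> \esum_(x in E) (qf A x)%:E = tail l 0.
Proof.
move=> Eb; under eq_esum do rewrite -sd_qf.
rewrite esum_nneseries; last by move=> *; rewrite lee_fin mulr_ge0 ?csq_ge0.
apply: eq_eseriesr => i _; rewrite parsevalZ// sd_nsq.
by case: eqP => [->|_]; rewrite ?mulr1// mul0r.
Qed.

(** An eigenvector for [t], stripped of its components along the [e i] with [l i = t], is orthogonal
    to every [e i]; then [sd_max] at an index [N] with [l N < t] forces it to vanish. *)
Lemma sd_eigenvalue_sequence : eigenvalue_sequence A l.
Proof.
split; [exact: (sd_mono sd)|exact: l0|] => t t0.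
have [N lN] := sd_small t0.
pose S := [seq i <- iota 0 N | l i == t].
have uS : uniq S by rewrite filter_uniq ?iota_uniq.
have SE i : (i \in S) = (l i == t).
  rewrite mem_filter mem_iota add0n; case: eqP => //= lit.
  rewrite ltnNge; apply/negP => Ni; have := sd_mono sd Ni; rewrite lit; lra.
have eS : sub_orthonormal [set` S] e by move=> i j _ _; exact: (sd_orth sd).
have eneq i : l i = t -> e i != 0 by move=> lit; rewrite (sd_neq0 sd) lit gt_eqF.
exists (size S); last first.
  have -> : [set i | l i = t] = [set` [fset i in S]%fset].
    apply/seteqP; split => i /=; rewrite in_fset SE; first by move=> ->.
    by move=> /eqP.
  by apply/card_eq_fsetP; rewrite card_fseq undup_id.
exists (fun j : 'I_(size S) => e (nth 0%N S j)).
  move=> c /(congr1 (fun y => hdot y _)) h i; have := h (e (nth 0%N S i)).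
  rewrite hdot0l hdot_suml (bigD1 i)//= big1 => [|j ji].
    rewrite addr0 hdotZl (sd_orth sd)// eqxx eneq ?mulr1//.
    by apply/eqP; rewrite -SE mem_nth.
  rewrite hdotZl (sd_orth sd)// nth_uniq// -val_eqE /= in ji *.
  by rewrite (negPf ji) mulr0.
apply/seteqP; split => x.
  rewrite /Defs.eigenspace /= => Ax; pose y := x - oproj S e x.
  have Ap : A (oproj S e x) = t%:C *: oproj S e x.
    rewrite /oproj (linear_op_sum Al) scaler_sumr; apply: eq_big_seq => i; rewrite SE => /eqP lit.
    by rewrite (linear_opZ Al) (sd_eigen sd) lit !scalerA mulrC.
  have Ay : A y = t%:C *: y by rewrite /y (linear_opD Al) (linear_opN Al) Ax Ap scalerBr.
  have yo i : hdot y (e i) = 0.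
    have [lit|lit] := eqVneq (l i) t; first by rewrite hdot_sub_proj// SE lit.
    have := hdot_selfadj Al A0 y (e i).
    rewrite Ay (sd_eigen sd) hdotZl hdotZr => /eqP.
    rewrite -subr_eq0 -mulrBl mulf_eq0 => /orP[|/eqP//].
    rewrite subr_eq0 => /eqP/(congr1 Re); rewrite cRe_conj/= => tl.
    by rewrite tl eqxx in lit.
  have y0 : y = 0.
    apply: nsq_eq0; apply/eqP; rewrite eq_le nsq_ge0 andbT leNgt; apply/negP => y0.
    have := @sd_max _ _ _ _ _ sd N y (fun i _ => yo i).
    rewrite /qf Ay hdotZl hdotxx !complexRI /= mul0r subr0 ler_pM2r// leNgt.
    by rewrite lN.
  have -> : x = oproj S e x by apply/eqP; rewrite -subr_eq0; apply/eqP.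
  exists (size S), (fun j => hdot x (e (nth 0%N S j))), (fun j => e (nth 0%N S j)).
  split; first by move=> i; exists i.
  by rewrite /oproj (big_nth 0%N) big_mkord.
move=> [m [c [v [vE ->]]]]; rewrite /Defs.eigenspace /= (linear_op_sum Al) scaler_sumr.
apply: eq_bigr => i _; have [j _ <-] := vE i.
rewrite (linear_opZ Al) (sd_eigen sd) !scalerA mulrC; congr (_ * _ *: _).
by have : nth 0%N S j \in S by [rewrite mem_nth]; rewrite SE => /eqP ->.
Qed.

(** The weight that the family gives to [l i] is [sum_j |<f_j, e_i>|^2]. Bessel's inequality, used
    in both directions, bounds it by 1 for each [i] and by [size r] in total, and [bathtub]
    concludes. *)
Lemma ky_fan (I : choiceType) (r : seq I) (f : I -> H) k : uniq r ->
  sub_orthonormal [set` r] f -> (size r <= k)%N ->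
  \sum_(i <- r) qf A (f i) <= \sum_(0 <= i < k) l i.
Proof.
move=> ur fo rk; rewrite -lee_fin -sumEFin.
under eq_bigr do rewrite -sd_qf.
rewrite -nneseries_sum; last by move=> *; rewrite lee_fin mulr_ge0 ?csq_ge0.
apply: nneseries_le => [i|n].
  by apply: sume_ge0 => j _; rewrite lee_fin mulr_ge0 ?csq_ge0.
under eq_bigr do rewrite sumEFin -mulr_sumr.
rewrite sumEFin lee_fin; apply: bathtub => //.
- exact: (sd_mono sd).
- move=> i; rewrite sumr_ge0 => [/=|j _]; last exact: csq_ge0.
  under eq_bigr do rewrite csq_hdotC.
  exact: le_trans (bessel _ ur fo) (sd_nsq_le1 i).
rewrite exchange_big/=; apply: (@le_trans _ _ (\sum_(j <- r) 1)).
  rewrite big_seq [leRHS]big_seq; apply: ler_sum => j jr.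
  apply: le_trans (_ : nsq (f j) <= 1).
    rewrite /index_iota subn0; apply: bessel; first exact: iota_uniq.
    by move=> a b _ _; exact: (sd_orth sd).
  by rewrite (sub_orthonormal_nsq fo)//; case: (_ != _).
by rewrite big_const_seq count_predT iter_addr_0 ler_nat.
Qed.

End decomposition.

(* Courant-Fischer: m + 1 orthonormal eigenvectors against m constraints. *)
Lemma minmax A m (f : 'I_m.+1 -> H) (mu : 'I_m.+1 -> R) (g : 'I_m -> H) t :
  linear A -> (forall i j, hdot (f i) (f j) = (i == j)%:R) ->
  (forall i, A (f i) = (mu i)%:C *: f i) -> (forall i, t <= mu i) ->
  exists x, [/\ 0 < nsq x, forall j, hdot x (g j) = 0 & t * nsq x <= qf A x].
Proof.
move=> Al fo Af tmu.
have [r r0 rM] := exists_left_kernel (\matrix_(i < m.+1, j < m) hdot (f i) (g j)) (leqnn _).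
have dotf (a b : 'I_m.+1 -> R[i]) :
    Re (hdot (\sum_i a i *: f i) (\sum_i b i *: f i)) = \sum_i Re (a i * Num.conj (b i)).
  rewrite hdot_suml Re_sum; apply: eq_bigr => i _.
  rewrite hdot_sumr (bigD1 i)//= big1 ?addr0 => [|j ji].
    by rewrite hdotZl hdotZr fo eqxx mulr1.
  by rewrite hdotZl hdotZr fo eq_sym (negPf ji) !mulr0.
exists (\sum_i r 0 i *: f i).
have nx : nsq (\sum_i r 0 i *: f i) = \sum_i csq (r 0 i).
  by rewrite /nsq dotf; apply: eq_bigr => i _; rewrite -csqE.
split.
- rewrite nx lt_def sumr_ge0 ?andbT; last by move=> i _; exact: csq_ge0.
  apply: contra_neq r0 => s0; apply/rowP => i; rewrite mxE; apply: csq_eq0.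
  have := psumr_eq0P (fun i _ => csq_ge0 (r 0 i)) s0; exact.
- move=> j; rewrite hdot_suml.
  have := congr1 (fun M : 'rV_m => M 0 j) rM; rewrite !mxE => h.
  by rewrite -[RHS]h; apply: eq_bigr => i _; rewrite hdotZl mxE.
- rewrite nx /qf (linear_op_sum Al).
  rewrite (eq_bigr (fun i => ((mu i)%:C * r 0 i) *: f i)); last first.
    by move=> i _; rewrite (linear_opZ Al) Af scalerA mulrC.
  rewrite dotf mulr_sumr; apply: ler_sum => i _.
  rewrite -mulrA -csqE -rmorphM /=; by rewrite ler_wpM2r ?csq_ge0.
Qed.

Lemma exists_orthonormal_basis : exists E : set H, orthonormal_basis E.
Proof. by have [|E _ Eb] := @orthonormal_extension _ H set0; [move=> ? ? []|exists E]. Qed.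

Lemma has_traceP A : positive_operator A -> has_trace A 1 <->
  forall E, orthonormal_basis E -> \esum_(x in E) (qf A x)%:E = 1%:E.
Proof.
move=> A0; split => [tA E Eb|tA E Eb].
  have [t t1 tE] := has_sum_esum (fun e _ => A0 e) (tA E Eb).
  by rewrite tE (_ : t = 1)//; apply: complexI; rewrite -t1.
by apply: (@esum_has_sum _ _ _ _ _ 1) => //; exact: tA.
Qed.

Lemma states_spectral A : states H A ->
  [/\ bounded_operator A, positive_operator A &
      exists l e, spectral_decomposition A l e /\ tail l 0 = 1%:E].
Proof.
move=> [A0 [Ab _] /has_traceP-/(_ A0) tA]; split => //.
have [E Eb] := exists_orthonormal_basis.
have [l [e [sd lT]]] := spectral_theorem Ab A0 Eb (tA E Eb).
exists l, e; split => //; rewrite -(sd_trace Ab A0 sd _ Eb) ?tA//.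
by rewrite (le_lt_trans lT) ?ltry.
Qed.

(** [has_trace] quantifies over all bases; [sd_trace] reduces it to one. A positive operator serves
    as its own absolute value. *)
Lemma states_criterion A E : bounded_operator A -> positive_operator A ->
  orthonormal_basis E -> \esum_(x in E) (qf A x)%:E = 1%:E -> states H A.
Proof.
move=> Ab A0 Eb AE; have Al := proj1 Ab.
have [l [e [sd lT]]] := spectral_theorem Ab A0 Eb AE.
have lfin : (tail l 0 < +oo)%E by rewrite (le_lt_trans lT) ?ltry.
have tA : has_trace A 1.
  apply/has_traceP => // E' Eb'; rewrite (sd_trace Ab A0 sd lfin Eb').
  by rewrite -(sd_trace Ab A0 sd lfin Eb).
split => //; split => //; exists A; split; last by exists 1.
by split => // x y.
Qed.

(** Uniqueness of the eigenvalue sequence carries the given weights over to [l]; from here on the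
    FA-property concerns [l] alone. *)
Lemma FA_property_log_tail A l e : bounded_operator A -> positive_operator A ->
  spectral_decomposition A l e -> (tail l 0 < +oo)%E ->
  FA_property A <-> log_tail l.
Proof.
move=> Ab A0 sd lfin; have l0 := sd_ge0 sd; have dl := sd_mono sd.
have El := sd_eigenvalue_sequence Ab A0 sd lfin.
split => [[l' El' [g [g0 lg gF]]]|lt].
  rewrite (eigenvalue_sequence_unique El' El) in lg.
  exact: FA_log_tail lg gF.
by exists l => //; exact: log_tail_FA.
Qed.

End spectral_consequences.

(** * Convexity *)

Section convexity.
Context {R : realType}.
Local Notation Re := (@complex.Re R).
Local Open Scope complex_scope.

Lemma esum_scale (I : choiceType) (D : set I) (a : I -> R) (t p : R) : 0 <= p ->
  \esum_(i in D) (a i)%:E = t%:E -> \esum_(i in D) (p * a i)%:E = (p * t)%:E.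
Proof.
move=> p0 at_; apply/eqP; rewrite eq_le; apply/andP; split.
  apply: esum_le_seq => r ur rD; rewrite -mulr_sumr lee_fin ler_wpM2l//.
  by rewrite -lee_fin -at_; exact: esum_ge_seq.
apply/lee_addgt0Pr => d d0; have p1 : 0 < p + 1 by rewrite ltr_wpDl.
have [r [ur rD tr]] := esum_adherent at_ (divr_gt0 d0 p1).
apply: (@le_trans _ _ ((\sum_(i <- r) p * a i)%:E + d%:E)%E); last first.
  by rewrite leeD2r//; exact: esum_ge_seq.
rewrite -mulr_sumr -EFinD lee_fin.
have pd : p * (d / (p + 1)) <= d.
  by rewrite mulrA ler_pdivrMr// mulrC ler_wpM2l ?(ltW d0)// lerDl.
have := ler_wpM2l p0 (ltW tr); rewrite mulrBr; lra.
Qed.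

Section weyl.
Context {H : hilbertType R}.
Variables (A B C : H -> H) (p q : R).
Hypotheses (p0 : 0 <= p) (q0 : 0 <= q).
Hypothesis CE : forall x, qf C x = p * qf A x + q * qf B x.
Variables (lA lB lC : nat -> R) (eA eB eC : nat -> H).
Hypotheses (sA : spectral_decomposition A lA eA)
  (sB : spectral_decomposition B lB eB) (sC : spectral_decomposition C lC eC).
Hypothesis Cl : linear C.

(** Among [2 i + 1] leading eigenvectors of [C], [minmax] finds a combination orthogonal to the
    first [i] eigenvectors of [A] and of [B], where both forms are controlled by [sd_max]. A zero
    eigenvalue of [C] is set apart because its vector is zero. *)
Lemma weyl i : lC i.*2 <= p * lA i + q * lB i.
Proof.
have f0 : 0 <= p * lA i + q * lB i.
  by rewrite addr_ge0// mulr_ge0// ?(sd_ge0 sA) ?(sd_ge0 sB).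
have [->//|l0] := eqVneq (lC i.*2) 0.
have lp : 0 < lC i.*2 by rewrite lt_def l0 (sd_ge0 sC).
have lj (j : 'I_i.*2.+1) : lC i.*2 <= lC j by apply: (sd_mono sC); rewrite -ltnS.
have ej (j : 'I_i.*2.+1) : eC j != 0.
  by rewrite (sd_neq0 sC) gt_eqF// (lt_le_trans lp).
have [j j'|j|j|x [nx gx tx]] := @minmax _ _ C i.*2 (fun j => eC j) (fun j => lC j)
    (fun j => if (j < i)%N then eA j else eB (j - i)%N) (lC i.*2) Cl.
- by rewrite (sd_orth sC)// ej andbT.
- exact: (sd_eigen sC).
- exact: lj.
rewrite -(ler_pM2r nx) (le_trans tx)// CE mulrDl -!mulrA lerD//.
  rewrite ler_wpM2l//; apply: (sd_max sA) => j ji.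
  have j2 : (j < i.*2)%N by rewrite -addnn ltn_addr.
  by have := gx (Ordinal j2); rewrite /= ji.
rewrite ler_wpM2l//; apply: (sd_max sB) => j ji.
have j2 : (i + j < i.*2)%N by rewrite -addnn ltn_add2l.
by have := gx (Ordinal j2); rewrite /= ltnNge leq_addr/= addKn.
Qed.

End weyl.

Lemma state_conv (H : hilbertType R) (A B : H -> H) (p : R) : 0 <= p <= 1 ->
  states H A -> states H B ->
  states H (fun x => p%:C *: A x + (1 - p)%:C *: B x).
Proof.
move=> /andP[p0 p1] stA stB.
have q0 : 0 <= 1 - p by rewrite subr_ge0.
have [Ab A0 _] := states_spectral stA; have [Bb B0 _] := states_spectral stB.
have [_ _ /has_traceP-/(_ A0) tA] := stA; have [_ _ /has_traceP-/(_ B0) tB] := stB.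
have [E Eb] := @exists_orthonormal_basis R H.
have [[Al [M1 h1]] [Bl [M2 h2]]] := (Ab, Bb).
have qE x : qf (fun x => p%:C *: A x + (1 - p)%:C *: B x) x = p * qf A x + (1 - p) * qf B x.
  by rewrite /qf hdotDl !hdotZl !complexRI /=; ring.
apply: (@states_criterion R H _ E) => //.
- split.
    move=> a x y; rewrite (linear_opD Al) (linear_opD Bl) (linear_opZ Al) (linear_opZ Bl) !scalerDr !scalerA.
    by rewrite addrACA (mulrC p%:C) (mulrC (1 - p)%:C).
  exists (p%:C * M1 + (1 - p)%:C * M2) => x; apply: (le_trans (ler_normD _ _)).
  rewrite !normrZ mulrDl -!mulrA !ger0_norm ?ler0c//.
  by rewrite lerD// ler_wpM2l ?ler0c.
- move=> x; rewrite hdotDl !hdotZl.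
  by rewrite addr_ge0// mulr_ge0// ?ler0c ?A0 ?B0.
- under eq_esum do rewrite qE EFinD.
  rewrite esumD; last 2 first.
  + by move=> x _; rewrite lee_fin mulr_ge0 ?qf_ge0.
  + by move=> x _; rewrite lee_fin mulr_ge0 ?qf_ge0.
  rewrite (esum_scale p0 (tA E Eb)) (esum_scale q0 (tB E Eb)) -EFinD.
  by congr EFin; ring.
Qed.

Lemma FA_states_conv (H : hilbertType R) (A B : H -> H) (p : R) : 0 <= p <= 1 ->
  FA_states H A -> FA_states H B ->
  FA_states H (fun x => p%:C *: A x + (1 - p)%:C *: B x).
Proof.
move=> p01 [stA FA] [stB FB]; have stC := state_conv p01 stA stB.
case/andP: p01 => p0 p1; have q0 : 0 <= 1 - p by rewrite subr_ge0.
split => //.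
have [Ab A0 [lA [eA [sA tA]]]] := states_spectral stA.
have [Bb B0 [lB [eB [sB tB]]]] := states_spectral stB.
have [Cb C0 [lC [eC [sC tC]]]] := states_spectral stC.
have fin1 (l : nat -> R) : tail l 0 = 1%:E -> (tail l 0 < +oo)%E by move=> ->; rewrite ltry.
have /(FA_property_log_tail Ab A0 sA (fin1 _ tA)) dA := FA.
have /(FA_property_log_tail Bb B0 sB (fin1 _ tB)) dB := FB.
apply/(FA_property_log_tail Cb C0 sC (fin1 _ tC)).
have lA0 := sd_ge0 sA; have lB0 := sd_ge0 sB.
have lk0 (k : 'I_2) i : 0 <= (if k == 0 then lA else lB) i by case: ifP.
(* The tail of [C] at [2 m] is at most twice the sum of the tails at [m], the coefficients [p] and
   [1 - p] being bounded by 1. *)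
apply: (@log_tail_le R 2 (fun k => if k == 0 then lA else lB) lC 2 2 1) => //.
- exact: (sd_ge0 sC).
- move=> m; rewrite expn1.
  apply: (le_trans (tail_double_le m (sd_ge0 sC) (sd_mono sC) (f := fun i => lA i + lB i) _)).
    move=> i.
    apply: (le_trans (@weyl H A B _ p (1 - p) p0 q0 _ _ _ _ _ _ _ sA sB sC (proj1 Cb) i)).
      by move=> x; rewrite /qf hdotDl !hdotZl !complexRI /=; ring.
    by rewrite lerD// ler_piMl// lerBlDr lerDl.
  rewrite lee_wpmul2l ?lee_fin//.
  rewrite big_ord_recl big_ord1/= /tail -nneseriesD; last 2 first.
  + by move=> i _ _; rewrite lee_fin.
  + by move=> i _ _; rewrite lee_fin.
  by under eq_eseriesr do rewrite EFinD.
- by move=> k; case: ifP.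
Qed.

Lemma FA_states_convex (H : hilbertType R) : convex_set (FA_states H).
Proof.
move=> A B t; rewrite !inE => FA FB.
have t0 : 0 <= t%:num by [].
(* The coefficients of [convex_set] lie in the unit interval of [R[i]], which consists of real
   numbers. *)
have [p tp] : exists p : R, t%:num = p%:C by exists (Re t%:num); exact: real_complex_Re.
have p01 : 0 <= p <= 1.
  have t1 : t%:num <= 1 by [].
  apply/andP; split; first by rewrite -ler0c -tp.
  by rewrite -lecR rmorph1 -tp.
have := FA_states_conv p01 FA FB; rewrite rmorphB/= -tp.
exact.
Qed.

End convexity.

(** * Product bases *)

Section tensor_basics.
Context {R : realType} {n : nat} {H : 'I_n -> hilbertType R}.
Variable T : hilbert_tensor H.
Local Notation Re := (@complex.Re R).
Local Open Scope complex_scope.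
Implicit Types (u v : forall k, H k).

Lemma nsq_tens u : nsq (tens T u) = \prod_(k < n) nsq (u k).
Proof.
rewrite /nsq tens_hdot (eq_bigr (fun k => (nsq (u k))%:C)) => [|k _]; last exact: hdotxx.
by rewrite -rmorph_prod.
Qed.

(** Tested against elementary tensors, whose span is dense; this replaces an iteration of
    [tens_multilinear] over the slots. *)
Lemma tens_scale (a : 'I_n -> R[i]) u :
  tens T (fun k => a k *: u k) = (\prod_(k < n) a k) *: tens T u.
Proof.
apply/eqP; rewrite -subr_eq0; apply/eqP.
apply: (dense_lspan_eq0 (@tens_dense _ _ _ T)) => _ [v _ <-].
rewrite hdotDl hdotNl hdotZl !tens_hdot -big_split/=.
by apply/eqP; rewrite subr_eq0; apply/eqP/eq_bigr => k _; rewrite hdotZl.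
Qed.

Variable E : forall k, set (H k).
Arguments E : clear implicits.

Let W : set (forall k, H k) := [set u | forall k, E k (u k)].

Lemma tens_hdot_onb u v : (forall k, orthonormal_set (E k)) -> W u -> W v ->
  hdot (tens T u) (tens T v) = (u == v)%:R.
Proof.
move=> Eo Wu Wv; rewrite tens_hdot; have [<-|uv] := eqVneq u v.
  by rewrite big1// => k _; rewrite (Eo k)// eqxx.
have [k uvk] : exists k, u k != v k.
  apply/not_existsP => h; case/eqP: uv; apply: functional_extensionality_dep => k.
  by apply/eqP/negPn/negP/h.
by rewrite (bigD1 k)//= (Eo k)// (negPf uvk) mul0r.
Qed.

Lemma tens_sub_orthonormal (D : set (forall k, H k)) :
  (forall k, orthonormal_set (E k)) -> D `<=` W -> sub_orthonormal D (tens T).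
Proof.
move=> Eo DW u v /DW Wu /DW Wv; rewrite tens_hdot_onb//.
suff -> : tens T u != 0 by rewrite andbT.
apply/eqP => u0; have := tens_hdot_onb Eo Wu Wu; rewrite u0 hdot0l eqxx => /eqP.
by rewrite eq_sym oner_eq0.
Qed.

Lemma tens_inj : (forall k, orthonormal_set (E k)) -> set_inj W (tens T).
Proof.
move=> Eo u v; rewrite !inE => Wu Wv uv; apply/eqP/negPn/negP => nuv.
have := tens_hdot_onb Eo Wu Wv; rewrite uv (tens_hdot_onb Eo Wv Wv) eqxx (negPf nuv).
by move=> /eqP; rewrite oner_eq0.
Qed.

Lemma tens_linear u k : linear (fun x : H k => tens T (dfwith u k x)).
Proof. by move=> a x y; exact: tens_multilinear. Qed.

Lemma nsq_tens_dfwith u k x :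
  nsq (tens T (dfwith u k x)) = (\prod_(l < n | l != k) nsq (u l)) * nsq x.
Proof.
rewrite nsq_tens (bigD1 k)//= dfwithin mulrC; congr (_ * _).
by apply: eq_bigr => l lk; rewrite dfwithout// eq_sym.
Qed.

(** A vector orthogonal to the product basis is shown orthogonal to all elementary tensors by
    freeing one slot at a time, each by density of the span of [E k]. *)
Lemma tens_orthonormal_basis : (forall k, orthonormal_basis (E k)) ->
  orthonormal_basis (tens T @` W).
Proof.
move=> Eb; have Eo k := orthonormal_basis_set (Eb k).
apply: onb_criterion.
  move=> _ _ [u Wu <-] [v Wv <-]; rewrite (tens_hdot_onb Eo Wu Wv).
  suff -> : (tens T u == tens T v) = (u == v) by [].
  by apply/eqP/eqP => [h|->//]; apply: (tens_inj Eo); rewrite ?inE.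
move=> z zW; apply: (dense_lspan_eq0 (@tens_dense _ _ _ T)) => _ [u _ <-].
(* [j] counts the freed slots: [v k] is arbitrary for [k < j] and a basis vector otherwise. *)
suff h j : (j <= n)%N -> forall v, (forall k : 'I_n, (j <= k)%N -> E k (v k)) ->
    hdot z (tens T v) = 0.
  by apply: (h n (leqnn n)) => k; rewrite leqNgt ltn_ord.
elim: j => [_ v vE|j IH jn v vE]; first by apply: zW; exists v => // k; exact: vE.
pose k := Ordinal jn; pose c := \prod_(l < n | l != k) nsq (v l).
have c0 : 0 <= c by apply: prodr_ge0 => l _; exact: nsq_ge0.
have vv : v = dfwith v k (v k).
  apply: functional_extensionality_dep => l; have [<-|kl] := eqVneq k l; first by rewrite dfwithin.
  by rewrite dfwithout.
have lin := @tens_linear v k.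
have hz x : lspan (E k) x -> hdot z (tens T (dfwith v k x)) = 0.
  move=> [m [a [w [wE ->]]]]; rewrite (linear_op_sum lin) hdot_sumr big1// => i _.
  rewrite (linear_opZ lin) hdotZr IH ?mulr0//; first exact: ltnW.
  move=> l jl; have [<-|kl] := eqVneq k l; first by rewrite dfwithin.
  by rewrite dfwithout//; apply: vE; rewrite ltn_neqAle jl andbT.
rewrite vv; apply: csq_eq0; apply/eqP; rewrite eq_le csq_ge0 andbT.
apply/ler_addgt0Pr => d d0; rewrite add0r; pose N := nsq z * c + 1.
have N0 : 0 < N by rewrite ltr_wpDl// mulr_ge0 ?nsq_ge0.
have [_ /dense_nsq dE] := Eb k.
have [s sE vs] := dE (v k) (d / N) (divr_gt0 d0 N0).
rewrite -[v k](subrK s) (linear_opD lin) hdotDr (hz s sE) addr0.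
apply: le_trans (CauchySchwarz_nsq _ _) _; rewrite nsq_tens_dfwith mulrA.
apply: (@le_trans _ _ (N * (d / N))); last by rewrite mulrC divfK// gt_eqF.
by apply: ler_pM; rewrite ?mulr_ge0 ?nsq_ge0// lerDl.
Qed.

End tensor_basics.

(** * Orthonormal bases adapted to a spectral decomposition *)

Section sd_basis.
Context {R : realType} {H : hilbertType R}.
Local Open Scope complex_scope.
Variables (A : H -> H) (l : nat -> R) (e : nat -> H).
Hypotheses (Ab : bounded_operator A) (A0 : positive_operator A).
Hypotheses (sd : spectral_decomposition A l e) (lfin : (tail l 0 < +oo)%E).

Lemma sd_basis : exists2 E : set H, orthonormal_basis E &
  forall i, l i != 0 -> E (e i).
Proof.
have [|E eE Eb] := @orthonormal_extension R H (e @` [set i | l i != 0]).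
  move=> _ _ [i /= li <-] [j /= lj <-]; rewrite (sd_orth sd)// (sd_neq0 sd) li andbT.
  have [->|ij] := eqVneq i j; first by rewrite eqxx.
  have [eij|//] := eqVneq (e i) (e j).
  have := @sd_orth _ _ _ _ _ sd i j Logic.I Logic.I; rewrite (negPf ij) eij hdotxx (sd_nsq sd) lj.
  by move=> /eqP; rewrite oner_eq0.
by exists E => // i li; apply: eE; exists i.
Qed.

(** A basis vector outside the eigenvector family is orthogonal to it, so its form value is 0, and
    [positive_CS] turns this into [A x = 0]. *)
Lemma sd_basis_cases E x : orthonormal_set E -> (forall i, l i != 0 -> E (e i)) -> E x ->
  (exists2 i, l i != 0 & x = e i) \/ A x = 0.
Proof.
move=> Eo eE Ex; have [|nx] := pselect (exists2 i, l i != 0 & x = e i); first by left.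
right; have qx : qf A x = 0.
  apply/EFin_inj; rewrite -(sd_qf Ab A0 sd lfin x) eseries0// => i _ _.
  have [->|li] := eqVneq (l i) 0; first by rewrite mul0r.
  rewrite (Eo x _ Ex (eE i li)); case: eqP => [xe|_]; last by rewrite csq0 mulr0.
  by case: nx; exists i.
apply: nsq_eq0; have := positive_CS (proj1 Ab) A0 x (A x).
rewrite qx mul0r hdotxx csq_real => h.
by apply/eqP; rewrite -sqrf_eq0 eq_le h sqr_ge0.
Qed.

Lemma sd_basis_eigen E x : orthonormal_set E -> (forall i, l i != 0 -> E (e i)) -> E x ->
  A x = (qf A x)%:C *: x.
Proof.
move=> Eo eE Ex; have [[i li ->]|Ax] := sd_basis_cases Eo eE Ex.
  by rewrite /qf (sd_eigen sd) hdotZl hdotxx (sd_nsq sd) li mulr1.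
by rewrite /qf Ax hdot0l scale0r.
Qed.

Lemma sd_qf_eigenvector i : qf A (e i) = l i.
Proof.
rewrite /qf (sd_eigen sd) hdotZl hdotxx (sd_nsq sd).
by case: eqP => [->|_]; rewrite !complexRI /=; ring.
Qed.

(** Only the eigenvectors of index at least [m] are seen by [D], and Parseval over a basis
    containing [D] bounds the share of each by [l i]. *)
Lemma sd_partial_trace_le (D : set H) m : orthonormal_set D ->
  (forall x i, D x -> (i < m)%N -> hdot x (e i) = 0) ->
  (\esum_(x in D) (qf A x)%:E <= tail l m)%E.
Proof.
move=> Do De; have [E DE Eb] := orthonormal_extension Do.
have l0 := sd_ge0 sd.
under eq_esum do rewrite -(sd_qf Ab A0 sd lfin).
rewrite esum_nneseries; last by move=> *; rewrite lee_fin mulr_ge0 ?csq_ge0.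
rewrite (@nneseries_split _ _ 0%N m) => [|i _]; last first.
  by apply: esum_ge0 => *; rewrite lee_fin mulr_ge0 ?csq_ge0.
rewrite add0n big_nat_cond big1 ?add0e; last first.
  move=> i /andP[/andP[_ im] _]; apply: esum1 => x Dx.
  by rewrite De// csq0 mulr0.
rewrite /tail; rewrite eseries_cond [leRHS]eseries_cond.
apply: lee_nneseries => i _.
  by move=> _; apply: esum_ge0 => *; rewrite lee_fin mulr_ge0 ?csq_ge0.
apply: (@le_trans _ _ (\esum_(x in E) (l i * csq (hdot x (e i)))%:E)).
  rewrite esum_mkcond [leRHS]esum_mkcond; apply: le_esum => x _.
  case: ifPn => [|_]; first by rewrite inE => /DE xE; rewrite mem_set.
  by case: ifP => _; rewrite ?lee_fin ?mulr_ge0 ?csq_ge0.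
by rewrite parsevalZ// lee_fin ler_piMr// (sd_nsq_le1 sd).
Qed.

End sd_basis.

(** On finite combinations [s] of basis vectors the form is visibly nonnegative; [<A z, z>] is a
    limit of such values, hence real and nonnegative. *)
Lemma positive_diag (R : realType) (H : hilbertType R) (A : H -> H) (E : set H)
    (mu : H -> R) : bounded_operator A -> orthonormal_basis E ->
  (forall e, E e -> A e = (mu e)%:C%C *: e) -> (forall e, E e -> 0 <= mu e) ->
  positive_operator A.
Proof.
move=> Ab Eb AE mu0 z; have Al := proj1 Ab; have [C C0 AC] := bounded_nsq Ab.
have Eo := orthonormal_basis_set Eb; have [_ /dense_nsq dE] := Eb.
set w := hdot (A z) z.
(* The constant in [csq (<A z, z> - <A s, s>) <= K * d'] when [nsq (z - s) <= d' <= 1], where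
   [nsq s <= 2 (nsq z + 1)]. *)
pose K := 2 * (C * nsq z + C * (2 * (nsq z + 1))) + 1.
have nz := nsq_ge0 z.
have K0 : 0 < K by rewrite /K; have := mulr_ge0 (ltW C0) nz; nra.
have approx d : 0 < d -> exists2 r : R, 0 <= r & csq (w - r%:C%C) <= d.
  move=> d0; pose d' := Num.min 1 (d / K).
  have d'0 : 0 < d' by rewrite lt_min ltr01 divr_gt0.
  have d'1 : d' <= 1 by rewrite ge_min lexx.
  have d'd : K * d' <= d by rewrite mulrC -ler_pdivlMr// ge_min lexx orbT.
  have [s /lspan_comb[r [a [ur rE sE]]] zs] := dE z d' d'0.
  have so := orthonormal_sub Eo rE.
  have As : hdot (A s) s = (\sum_(e <- r) csq (a e) * mu e)%:C%C.
    rewrite {1}sE (linear_op_sum Al) hdot_suml rmorph_sum/=; apply: eq_big_seq => e er.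
    rewrite (linear_opZ Al).
    rewrite (AE e (rE e er)).
    rewrite hdotZl.
 rewrite hdotZl sE hdot_sumr (bigD1_seq e)//= big1_seq ?addr0.
      by rewrite hdotZr (Eo _ _ (rE e er) (rE e er)) eqxx mulr1 rmorphM/= csqE; ring.
    move=> f /andP[fe fr]; rewrite hdotZr (Eo _ _ (rE e er) (rE f fr)).
    by rewrite eq_sym (negPf fe) mulr0.
  exists (\sum_(e <- r) csq (a e) * mu e).
    by rewrite big_seq sumr_ge0// => e er; rewrite mulr_ge0 ?csq_ge0// (mu0 _ (rE e er)).
  have -> : w - (\sum_(e <- r) csq (a e) * mu e)%:C%C = hdot (A (z - s)) z + hdot (A s) (z - s).
    by rewrite -As (linear_opD Al) (linear_opN Al) !hdotE; ring.
  apply: le_trans (csqD_le _ _) _; apply: le_trans d'd.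
  have h1 := CauchySchwarz_nsq (A (z - s)) z.
  have h2 := CauchySchwarz_nsq (A s) (z - s).
  have h3 : nsq (A (z - s)) * nsq z <= C * d' * nsq z.
    by rewrite ler_wpM2r// (le_trans (AC _))// ler_wpM2l ?(ltW C0).
  have sz : nsq s <= 2 * (nsq z + 1).
    rewrite (_ : s = z - (z - s)); last by rewrite opprB addrC subrK.
    by apply: le_trans (nsqB_le _ _) _; have := le_trans zs d'1; lra.
  have h4 : nsq (A s) * nsq (z - s) <= C * (2 * (nsq z + 1)) * d'.
    apply: ler_pM; rewrite ?nsq_ge0//; apply: (le_trans (AC _)).
    by rewrite ler_wpM2l ?(ltW C0).
  rewrite /K; nra.
have Im0 : complex.Im w = 0.
  apply/eqP/negPn/negP => Iw; have p : 0 < complex.Im w ^+ 2 by rewrite lt_def sqr_ge0 sqrf_eq0 Iw.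
  have [|r r0] := approx (complex.Im w ^+ 2 / 2); first by lra.
  rewrite /csq !complexRI /= oppr0 addr0.
  have := sqr_ge0 (complex.Re w - r); lra.
have Re0 : 0 <= complex.Re w.
  rewrite leNgt; apply/negP => Rw; have p : 0 < complex.Re w ^+ 2 by nra.
  have [|r r0] := approx (complex.Re w ^+ 2 / 2); first by lra.
  rewrite /csq !complexRI /= Im0; nra.
by rewrite (@complex_ext _ w (complex.Re w)%:C%C) ?ler0c.
Qed.

(** * States on tensor products *)

(** The union bound; one more factor is handled by [(1 - s) (1 - P) >= 0]. *)
Lemma prod_ge_1_sub (R : realType) (I : Type) (r : seq I) (s : I -> R) :
  (forall k, 0 <= s k <= 1) ->
  1 - \sum_(k <- r) (1 - s k) <= \prod_(k <- r) s k.
Proof.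
move=> s01; elim: r => [|k r IH]; first by rewrite !big_nil subr0.
have P1 : 0 <= \prod_(k <- r) s k <= 1.
  apply/andP; split; first by apply: prodr_ge0 => j _; case/andP: (s01 j).
  by apply: prodr_ile1 => j _; exact: s01.
rewrite !big_cons; case/andP: P1 => P0 P1; case/andP: (s01 k) => sk0 sk1.
have := mulr_ge0 (_ : 0 <= 1 - s k) (_ : 0 <= 1 - \prod_(k <- r) s k).
by rewrite !subr_ge0 => /(_ sk1 P1); lra.
Qed.

Section tensor_FA.
Context {R : realType} {n : nat} {H : 'I_n -> hilbertType R}.
Variable T : hilbert_tensor H.
Local Notation Re := (@complex.Re R).
Local Open Scope complex_scope.
Implicit Types (u v : forall k, H k).

Variables (rho_ : forall k, H k -> H k) (l : 'I_n -> nat -> R) (e : forall k, nat -> H k).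
Arguments rho_ : clear implicits.
Arguments e : clear implicits.
Hypotheses (rb : forall k, bounded_operator (rho_ k))
  (r0 : forall k, positive_operator (rho_ k))
  (rsd : forall k, spectral_decomposition (rho_ k) (l k) (e k))
  (l1 : forall k, tail (l k) 0 = 1%:E).

Let lfin k : (tail (l k) 0 < +oo)%E. Proof. by rewrite l1 ltry. Qed.
Let l0 k i : 0 <= l k i := sd_ge0 (rsd k) i.

Variable E : forall k, set (H k).
Arguments E : clear implicits.
Hypotheses (Eb : forall k, orthonormal_basis (E k))
  (eE : forall k i, l k i != 0 -> E k (e k i)).

Let Eo k := orthonormal_basis_set (Eb k).
Let W : set (forall k, H k) := [set u | forall k, E k (u k)].
Let Q u := \prod_(k < n) qf (rho_ k) (u k).

(** Indices with eigenvalue 0 are dropped: their vectors are all zero, so the list would otherwise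
    have repetitions. The sum of [Q] is unaffected. *)
Definition box m : seq (forall k, H k) :=
  [seq (fun k => e k (J k)) | J : {ffun 'I_n -> 'I_m} <-
     [seq J : {ffun 'I_n -> 'I_m} <- enum {ffun 'I_n -> 'I_m} | [forall k, l k (J k) != 0]]].

Lemma e_inj k i j : l k i != 0 -> e k i = e k j -> i = j.
Proof.
move=> li eij; apply/eqP/negPn/negP => ij.
have := @sd_orth _ _ _ _ _ (rsd k) i j Logic.I Logic.I.
rewrite (negPf ij) -eij hdotxx (sd_nsq (rsd k)) li => /eqP.
by rewrite oner_eq0.
Qed.

Lemma box_uniq m : uniq (box m).
Proof.
rewrite map_inj_in_uniq; first exact/filter_uniq/enum_uniq.
move=> J K.
rewrite !mem_filter => /andP[/forallP lJ _] _ JK; apply/ffunP => k.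
apply: val_inj; apply: (e_inj (lJ k)).
exact: (congr1 (fun f : forall k, H k => f k) JK).
Qed.

Lemma size_box m : (size (box m) <= m ^ n)%N.
Proof.
rewrite size_map size_filter (leq_trans (count_size _ _))//.
by rewrite -cardE card_ffun !card_ord.
Qed.

Lemma mem_box m u : (forall k, exists i, [/\ (i < m)%N, l k i != 0 & u k = e k i]) ->
  u \in box m.
Proof.
move=> /choice[f hf].
have fm k : (f k < m)%N by case: (hf k).
apply/mapP; exists [ffun k => Ordinal (fm k)].
  by rewrite mem_filter mem_enum andbT; apply/forallP => k; rewrite ffunE; case: (hf k).
by apply: functional_extensionality_dep => k; rewrite ffunE; case: (hf k).
Qed.

Lemma box_index m u : u \in box m ->
  forall k, exists i, [/\ (i < m)%N, l k i != 0 & u k = e k i].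
Proof.
move=> /mapP[J]; rewrite mem_filter => /andP[/forallP lJ _] -> k.
by exists (J k).
Qed.

Lemma box_mono m m' : (m <= m')%N -> {subset box m <= box m'}.
Proof.
move=> mm u /box_index h; apply: mem_box => k; have [i [im li ui]] := h k.
by exists i; split => //; exact: leq_trans mm.
Qed.

Lemma box_sub m : [set` box m] `<=` W.
Proof.
by move=> u /box_index h k; have [i [_ li ->]] := h k; exact: eE.
Qed.

Lemma sum_box m : \sum_(u <- box m) Q u = \prod_(k < n) \sum_(0 <= i < m) l k i.
Proof.
rewrite big_map big_filter.
under [RHS]eq_bigr do rewrite big_mkord.
rewrite bigA_distr_bigA/= big_enum_cond/= [RHS](bigID (fun J : {ffun 'I_n -> 'I_m} => [forall k, l k (J k) != 0]))/=.
rewrite [X in _ = _ + X]big1 ?addr0 => [|J /forallPn[k /negPn/eqP lJ]]; last first.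
  by rewrite (bigD1 k)//= lJ mul0r.
apply: eq_bigr => J _.
by apply: eq_bigr => k _; rewrite (sd_qf_eigenvector (rsd k)).
Qed.

Lemma sum_le1 k m : \sum_(0 <= i < m) l k i <= 1.
Proof.
by rewrite -lee_fin -[leRHS](l1 k) (tailD m (l0 k)) leeDl// tail_ge0.
Qed.

Lemma tail_real k m : (tail (l k) m = (1 - \sum_(0 <= i < m) l k i)%:E)%E.
Proof.
have := tailD m (l0 k); rewrite l1 => h; rewrite EFinB h addeAC subee// add0e.
by [].
Qed.

Lemma sum_box_ge m : 1 - \sum_(k < n) (1 - \sum_(0 <= i < m) l k i) <= \sum_(u <- box m) Q u.
Proof.
rewrite sum_box; apply: prod_ge_1_sub => k.
by rewrite sum_le1 andbT sumr_ge0.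
Qed.

Lemma Q_ge0 u : 0 <= Q u.
Proof. by apply: prodr_ge0 => k _; exact: qf_ge0. Qed.

Lemma sum_box_le1 m : \sum_(u <- box m) Q u <= 1.
Proof.
rewrite sum_box; apply: prodr_ile1 => k _.
by rewrite sum_le1 andbT sumr_ge0.
Qed.

(** The common end of both tensor product statements: [ky_fan] applied to the at most [m ^ n]
    vectors of the box, then [log_tail_le] with [p = 1] and [q = n]. *)
Lemma box_tail (rho : T -> T) (lr : nat -> R) (er : nat -> T) :
  bounded_operator rho -> positive_operator rho ->
  spectral_decomposition rho lr er -> tail lr 0 = 1%:E ->
  (forall m, 1 - \sum_(k < n) (1 - \sum_(0 <= i < m) l k i) <=
     \sum_(u <- box m) qf rho (tens T u)) ->
  (0 < n)%N -> (forall k, log_tail (l k)) -> log_tail lr.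
Proof.
move=> rhob rho0 sr tr hbox n0 lt.
have lr0 := sd_ge0 sr.
apply: (@log_tail_le R n l lr 1 1 n) => // m.
rewrite mul1n mul1e.
have trm := tailD (m ^ n) lr0; rewrite tr in trm.
have -> : tail lr (m ^ n) = (1 - \sum_(0 <= i < m ^ n) lr i)%:E.
  by rewrite EFinB trm addeAC subee// add0e.
rewrite (eq_bigr _ (fun k _ => tail_real k m)).
rewrite sumEFin lee_fin.
have : \sum_(u <- box m) qf rho (tens T u) <= \sum_(0 <= i < m ^ n) lr i.
  apply: (ky_fan rhob rho0 sr) => //; rewrite ?tr ?ltry ?box_uniq ?size_box//.
  exact: (tens_sub_orthonormal T Eo (@box_sub m)).
by have := hbox m; lra.
Qed.

(** * States with given marginals *)

Section marginals.
Variable rho : T -> T.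
Hypotheses (rhos : states T rho) (rho_marg : forall k, marginal rho k (rho_ k)).

Let rho0 : positive_operator rho. Proof. by case: rhos. Qed.

Lemma esum_marginal k x : E k x ->
  \esum_(u in [set u : forall l, H l | u k = 0 /\ forall l, l != k -> E l (u l)])
    (qf rho (tens T (dfwith u k x)))%:E = (qf (rho_ k) x)%:E.
Proof.
move=> Ex; have h := @rho_marg k E Eb x x.
by have [t hx ->] := has_sum_esum (fun u _ => rho0 _) h; rewrite /qf hx.
Qed.

Lemma esum_W : \esum_(u in W) (qf rho (tens T u))%:E = 1%:E.
Proof.
have [_ _ /has_traceP-/(_ rho0) tr] := rhos.
rewrite -(tr _ (tens_orthonormal_basis T Eb)).
by rewrite esum_image//; exact: tens_inj.
Qed.

(** The slabs cover the part of the product basis outside the box. *)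
Let slab k m : set (forall k, H k) :=
  [set u | W u /\ ~ exists i, [/\ (i < m)%N, l k i != 0 & u k = e k i]].

(** Summing out the other factors turns the mass of the slab into a partial trace sum of [rho_ k]
    over basis vectors orthogonal to its first [m] eigenvectors. *)
Lemma esum_slab k m :
  (\esum_(u in slab k m) (qf rho (tens T u))%:E <= tail (l k) m)%E.
Proof.
pose U := [set u : forall l, H l | u k = 0 /\ forall l, l != k -> E l (u l)].
pose D := [set x | E k x /\ ~ exists i, [/\ (i < m)%N, l k i != 0 & x = e k i]].
(* A basis tuple corresponds to its [k]-th component together with the tuple whose slot [k] is reset
   to the dummy 0 of [marginal]. *)
rewrite (@reindex_esum R _ _ (D `*` U) _ (fun p => dfwith p.2 k p.1)); last first.
  split.
  - move=> [x u] [/= [Ex nx] [_ Eu]]; split => /=; last by rewrite dfwithin.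
    by move=> j; case: dfwithP => // i ki; apply: Eu; rewrite eq_sym.
  - move=> [x u] [y v]; rewrite !inE => -[/= _ [u0 _]] [/= _ [v0 _]] xy.
    have h j := congr1 (fun f : forall l, H l => f j) xy.
    have := h k; rewrite /= !dfwithin => ->; congr pair.
    apply: functional_extensionality_dep => j; have [<-|kj] := eqVneq k j.
      by rewrite u0 v0.
    by have := h j; rewrite /= !dfwithout.
  - move=> u [Wu nu]; exists (u k, dfwith u k 0).
      split => //=; split; first by rewrite dfwithin.
      by move=> j jk; rewrite dfwithout 1?eq_sym.
    apply: functional_extensionality_dep => j /=; have [<-|kj] := eqVneq k j.
      by rewrite dfwithin.
    by rewrite !dfwithout.
have -> : \esum_(i in D `*` U) (qf rho (tens T (dfwith i.2 k i.1)))%:E =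
   \esum_(x in D) \esum_(u in U) (qf rho (tens T (dfwith u k x)))%:E.
  by rewrite esum_esum// => x u _ _; rewrite lee_fin qf_ge0.
rewrite (@eq_esum _ _ _ _ (fun x => (qf (rho_ k) x)%:E)); last first.
  by move=> x [Ex _]; exact: esum_marginal.
apply: (sd_partial_trace_le (rb k) (@r0 k) (rsd k) (lfin k)).
  by move=> x y [Ex _] [Ey _]; exact: Eo.
move=> x i [Ex nx] im; have [li|li] := eqVneq (l k i) 0.
  have : nsq (e k i) = 0 by rewrite (sd_nsq (rsd k)) li eqxx.
  by move=> /nsq_eq0 ->; rewrite hdot0r.
rewrite (Eo Ex (eE li)); case: eqP => // xe.
by case: nx; exists i.
Qed.

(** The total mass 1 is at most that of the box plus those of the slabs. *)
Lemma marginal_box m : 1 - \sum_(k < n) (1 - \sum_(0 <= i < m) l k i) <=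
  \sum_(u <- box m) qf rho (tens T u).
Proof.
pose F u := (qf rho (tens T u))%:E.
have F0 u : (0 <= F u)%E by rewrite lee_fin qf_ge0.
have h1 : (1%:E <= (\sum_(u <- box m) qf rho (tens T u))%:E + \sum_(k < n) tail (l k) m)%E.
  rewrite -esum_W (@esumID _ _ [set` box m] W F)//; apply: leeD.
    apply: esum_le_seq => r ur rW; rewrite lee_fin.
    have rb' : {subset r <= box m} by move=> u /rW[].
    by apply: ler_sum_subset => //; exact: box_uniq.
  apply: (@le_trans _ _ (\sum_(k < n) \esum_(u in slab k m) F u)); last first.
    by apply: lee_sum => k _; exact: esum_slab.
  have -> : \sum_(k < n) \esum_(u in slab k m) F u =
      \esum_(u in setT) \sum_(k < n) (if u \in slab k m then F u else 0)%E.
    rewrite esum_sum; last by move=> *; case: ifP.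
    by apply: eq_bigr => k _; rewrite esum_mkcond.
  rewrite esum_mkcond; apply: le_esum => u _; case: ifPn => [|_]; last first.
    by apply: sume_ge0 => k _; case: ifP.
  rewrite inE => -[Wu ub].
  have [k nk] : exists k, ~ exists i, [/\ (i < m)%N, l k i != 0 & u k = e k i].
    apply: contrapT => h; apply: ub; apply: mem_box => k.
    by apply: contrapT => nk; apply: h; exists k.
  rewrite (bigD1 k)//= mem_set//; rewrite leeDl//.
  by apply: sume_ge0 => j _; case: ifP.
move: h1; rewrite (eq_bigr _ (fun k _ => tail_real k m)).
by rewrite sumEFin -EFinD lee_fin; lra.
Qed.

End marginals.

(** * Product states *)

Section product.
Variable rho : T -> T.
Hypothesis rhoT : tensor_operator rho_ rho.

Let rhob : bounded_operator rho := proj1 rhoT.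

(** Every vector of [E k] is an eigenvector of [rho_ k], with eigenvalue 0 outside the spectral
    family. *)
Lemma rho_tens_eigen u : W u -> rho (tens T u) = (Q u)%:C *: tens T u.
Proof.
move=> Wu; rewrite (proj2 rhoT).
have -> : (fun k => rho_ k (u k)) = (fun k => (qf (rho_ k) (u k))%:C *: u k).
  apply: functional_extensionality_dep => k.
  exact: (sd_basis_eigen (rb k) (@r0 k) (rsd k) (lfin k) (@Eo k) (@eE k) (Wu k)).
by rewrite tens_scale -rmorph_prod.
Qed.

Lemma product_positive : positive_operator rho.
Proof.
have Tb := tens_orthonormal_basis T Eb.
apply: (positive_diag (mu := fun b => qf rho b) rhob Tb).
- move=> _ [u Wu <-]; rewrite /qf rho_tens_eigen// hdotZl hdotxx.
  by rewrite (_ : nsq _ = 1) ?mulr1// /nsq (tens_hdot_onb T Eo Wu Wu) eqxx.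
- move=> _ [u Wu <-]; rewrite /qf rho_tens_eigen// hdotZl hdotxx.
  by rewrite -rmorphM/= mulr_ge0 ?Q_ge0 ?nsq_ge0.
Qed.

Lemma qf_rho_tens u : W u -> qf rho (tens T u) = Q u.
Proof.
move=> Wu; rewrite /qf rho_tens_eigen// hdotZl (tens_hdot_onb T Eo Wu Wu) eqxx.
by rewrite mulr1.
Qed.

(** Both bounds go through boxes: finitely many tuples with [Q u != 0] lie in one box, of mass at
    most 1, and large boxes miss arbitrarily little. *)
Lemma product_trace : \esum_(b in tens T @` W) (qf rho b)%:E = 1%:E.
Proof.
rewrite esum_image; last exact: tens_inj.
rewrite (eq_esum (b := fun u => (Q u)%:E)); last by move=> u Wu; rewrite qf_rho_tens.
apply/eqP; rewrite eq_le; apply/andP; split.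
  apply: esum_le_seq => r ur rW; rewrite lee_fin.
  (* Tuples with [Q u = 0] may have components outside the eigenvector families, so no box need
     contain them. *)
  rewrite (bigID (fun u => Q u == 0))/= big1 ?add0r => [|u /eqP //].
  rewrite -big_filter; set r' := [seq u <- r | _].
  have [m rm] : exists m, {subset r' <= box m}.
    have hu u : u \in r' -> exists m, u \in box m.
      rewrite mem_filter => /andP[Qu /rW Wu].
      have /choice[f hf] : forall k, exists i, l k i != 0 /\ u k = e k i.
        move=> k; have [[i li ui]|ru] := sd_basis_cases (rb k) (@r0 k) (rsd k) (lfin k) (@Eo k) (@eE k) (Wu k).
          by exists i.
        have : Q u = 0 by rewrite /Q (bigD1 k)//= /qf ru hdot0l mul0r.
        by move=> Q0; rewrite Q0 eqxx in Qu.
      exists (\max_k f k).+1; apply: mem_box => k; exists (f k); case: (hf k) => ? ?; split => //.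
      by rewrite ltnS leq_bigmax.
    elim: r' hu => [|u s IH] hu; first by exists 0%N.
    have [m1 h1] := hu u (mem_head _ _).
    have [|m2 h2] := IH; first by move=> v vs; apply: hu; rewrite inE vs orbT.
    exists (maxn m1 m2) => v; rewrite inE => /predU1P[->|/h2].
      exact: (box_mono (leq_maxl _ _)).
    exact: (box_mono (leq_maxr _ _)).
  apply: le_trans (sum_box_le1 m).
  by apply: ler_sum_subset => // [||u]; [exact: filter_uniq|exact: box_uniq|exact: Q_ge0].
apply/lee_addgt0Pr => d d0.
have [m hm] : exists m, forall k, 1 - \sum_(0 <= i < m) l k i <= d / n.+1%:R.
  have dn : 0 < d / n.+1%:R by rewrite divr_gt0.
  have /choice[f hf] k : exists m, 1 - \sum_(0 <= i < m) l k i <= d / n.+1%:R.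
    have := nneseries_tail_cvg (lfin k) (fun i _ => l0 k i).
    move=> /fine_cvgP[_ /cvgrPdist_lt/(_ _ dn)][m _ /(_ m (leqnn m))] /=.
    rewrite -/(tail (l k) m) tail_real sub0r normrN /= => h; exists m.
    by apply: le_trans (ltW h); exact: ler_norm.
  exists (\max_k f k) => k; apply: le_trans (hf k).
  by rewrite -lee_fin -!tail_real tail_anti// leq_bigmax.
apply: (@le_trans _ _ ((\sum_(u <- box m) Q u)%:E + d%:E)%E); last first.
  rewrite leeD2r//; apply: esum_ge_seq; [exact: box_uniq|exact: box_sub].
rewrite -EFinD lee_fin; apply: le_trans (lerD (sum_box_ge m) (lexx d)).
suff : \sum_(k < n) (1 - \sum_(0 <= i < m) l k i) <= d by lra.
apply: (@le_trans _ _ (\sum_(k < n) d / n.+1%:R)); first by apply: ler_sum.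
rewrite sumr_const card_ord -[leLHS]mulr_natl mulrCA ger_pMr// ler_pdivrMr ?ltr0n// mul1r.
by rewrite ler_nat.
Qed.

Lemma product_state : states T rho.
Proof.
apply: (states_criterion rhob product_positive (tens_orthonormal_basis T Eb)).
exact: product_trace.
Qed.

Lemma product_box m : 1 - \sum_(k < n) (1 - \sum_(0 <= i < m) l k i) <=
  \sum_(u <- box m) qf rho (tens T u).
Proof.
apply: le_trans (sum_box_ge m) _; rewrite le_eqVlt; apply/orP; left; apply/eqP.
by apply: eq_big_seq => u /box_sub Wu; rewrite qf_rho_tens.
Qed.

(** Fixing top eigenvectors in the other factors embeds the spectrum of [rho_ k], scaled by [c],
    into that of [rho]; [minmax] with [i + 1] such tensors against the first [i] eigenvectors of
    [rho] compares the two at [i]. The scale is positive because a unit trace forces a positive top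
    eigenvalue. *)
Lemma product_eigenvalue_le (lr : nat -> R) (er : nat -> T) k :
  spectral_decomposition rho lr er ->
  exists2 c : R, 0 < c & forall i, c * l k i <= lr i.
Proof.
move=> sr; have l00 j : 0 < l j 0%N.
  rewrite lt_def l0 andbT; apply/eqP => lj0.
  have : tail (l j) 0 = 0.
    rewrite /tail eseries0// => i _ _.
    have := sd_mono (rsd j) (leq0n i); rewrite lj0 => h.
    by congr EFin; apply/eqP; rewrite eq_le h l0.
  by rewrite l1 => /eqP; rewrite eqe oner_eq0.
pose c := \prod_(j < n | j != k) l j 0%N.
have c0 : 0 < c by apply: prodr_gt0.
exists c => // i; have [->|li] := eqVneq (l k i) 0.
  by rewrite mulr0 (sd_ge0 sr).
have lip : 0 < l k i by rewrite lt_def li l0.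
have lj (j : 'I_i.+1) : l k i <= l k j by apply: (sd_mono (rsd k)); rewrite -ltnS.
have lj0 (j : 'I_i.+1) : l k j != 0 by rewrite gt_eqF// (lt_le_trans lip).
pose f (j : 'I_i.+1) : forall q, H q := dfwith (fun q => e q 0%N) k (e k j).
have fW j : W (f j).
  move=> q; rewrite /f; case: dfwithP => [|q' _]; first exact: eE.
  by apply: eE; rewrite gt_eqF.
have Qf j : Q (f j) = c * l k j.
  rewrite /Q (bigD1 k)//= /f dfwithin (sd_qf_eigenvector (rsd k)) mulrC; congr (_ * _).
  by apply: eq_bigr => q qk; rewrite dfwithout 1?eq_sym// (sd_qf_eigenvector (rsd q)).
have [j j'|j|j|x [nx gx tx]] := @minmax R T rho i (fun j => tens T (f j)) (fun j => c * l k j)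
    (fun j => er j) (c * l k i) (proj1 rhob).
- rewrite (tens_hdot_onb T Eo (fW j) (fW j')); congr (_%:R).
  suff -> : (f j == f j') = (j == j') by [].
  apply/eqP/eqP => [h|->//]; apply: val_inj; apply: (e_inj (lj0 j)).
  by have := congr1 (fun g : forall q, H q => g k) h; rewrite /f !dfwithin.
- by rewrite rho_tens_eigen// Qf.
- by rewrite ler_wpM2l ?(ltW c0)// lj.
rewrite -(ler_pM2r nx) (le_trans tx)//; apply: (sd_max sr) => j ji.
exact: (gx (Ordinal ji)).
Qed.

End product.

End tensor_FA.

Theorem proposition1 (R : realType) :
  (forall H : hilbertType R, separable_space H ->
     convex_set (FA_states H)) /\
  (forall (n : nat) (H : 'I_n -> hilbertType R) (T : hilbert_tensor H),
     (0 < n)%N -> (forall k, separable_space (H k)) ->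
     (forall (rho : T -> T) (rho_ : forall k, H k -> H k),
        states T rho ->
        (forall k, marginal rho k (rho_ k)) ->
        (forall k, FA_states (H k) (rho_ k)) ->
        FA_states T rho) /\
     (forall (rho_ : forall k, H k -> H k) (rho : T -> T),
        (forall k, states (H k) (rho_ k)) ->
        tensor_operator rho_ rho ->
        (FA_states T rho <-> forall k, FA_states (H k) (rho_ k)))).
Proof.
have lty (l : nat -> R) : tail l 0 = 1%:E -> (tail l 0 < +oo)%E by move=> ->; rewrite ltry.
split=> [H _|n H T n0 _]; first exact: FA_states_convex.
have decompose (rho_ : forall k, H k -> H k) : (forall k, states (H k) (rho_ k)) ->
    exists (l : 'I_n -> nat -> R) (e : forall k, nat -> H k) (E : forall k, set (H k)),
      [/\ forall k, spectral_decomposition (rho_ k) (l k) (e k),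
        forall k, tail (l k) 0 = 1%:E, forall k, orthonormal_basis (E k) &
        forall k i, l k i != 0 -> E k (e k i)].
  move=> st; have ex k : exists p : (nat -> R) * (nat -> H k) * set (H k),
      [/\ spectral_decomposition (rho_ k) p.1.1 p.1.2, tail p.1.1 0 = 1%:E,
        orthonormal_basis p.2 & forall i, p.1.1 i != 0 -> p.2 (p.1.2 i)].
    have [Ab A0 [l [e [sd l1]]]] := states_spectral (st k).
    by have [E Eb eE] := sd_basis sd; exists (l, e, E).
  pose d k := sval (cid (ex k)); have dE k := svalP (cid (ex k)).
  exists (fun k => (d k).1.1), (fun k => (d k).1.2), (fun k => (d k).2).
  by split=> k; have [] := dE k.
have FA_equiv (rho_ : forall k, H k -> H k) l e : (forall k, states (H k) (rho_ k)) ->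
    (forall k, spectral_decomposition (rho_ k) (l k) (e k)) ->
    (forall k, tail (l k) 0 = 1%:E) ->
    (forall k, FA_states (H k) (rho_ k)) <-> forall k, log_tail (l k).
  move=> st sd l1; split=> h k; have [Ab A0 _] := states_spectral (st k).
    by apply/(FA_property_log_tail Ab A0 (sd k) (lty _ (l1 k))); case: (h k).
  split; first exact: st.
  exact/(FA_property_log_tail Ab A0 (sd k) (lty _ (l1 k))).
split.
  move=> rho rho_ rhos marg FA; have st k : states (H k) (rho_ k) by case: (FA k).
  have [l [e [E [sd l1 Eb eE]]]] := decompose _ st.
  have rb k : bounded_operator (rho_ k) by case: (states_spectral (st k)).
  have r0 k : positive_operator (rho_ k) by case: (states_spectral (st k)).
  have [rhob rho0 [lr [er [sr lr1]]]] := states_spectral rhos.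
  split=> //; apply/(FA_property_log_tail rhob rho0 sr (lty _ lr1)).
  apply: (box_tail sd l1 Eb eE rhob rho0 sr lr1) => //.
    exact: (marginal_box rb r0 sd l1 Eb eE rhos marg).
  exact/(FA_equiv _ _ _ st sd l1).
move=> rho_ rho st rhoT.
have [l [e [E [sd l1 Eb eE]]]] := decompose _ st.
have rb k : bounded_operator (rho_ k) by case: (states_spectral (st k)).
have r0 k : positive_operator (rho_ k) by case: (states_spectral (st k)).
(* [tensor_operator] only provides boundedness and the values on elementary tensors; both directions
   need [rho] to be a state. *)
have rhos := product_state rb r0 sd l1 Eb eE rhoT.
have [rhob rho0 [lr [er [sr lr1]]]] := states_spectral rhos.
rewrite (FA_equiv _ _ _ st sd l1); split=> [[_ /(FA_property_log_tail rhob rho0 sr (lty _ lr1)) lt] k|lt].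
  have [c c0 cl] := product_eigenvalue_le rb r0 sd l1 Eb eE rhoT k sr.
  have lk0 := sd_ge0 (sd k).
  (* Here [l k <= c^-1 * lr] termwise, so the index is not distorted: [p = q = 1]. *)
  apply: (@log_tail_le R 1 (fun=> lr) (l k) c^-1 1 1) => //.
  - by move=> _; exact: (sd_ge0 sr).
  - by rewrite invr_ge0 ltW.
  - move=> m; rewrite big_ord1 mul1n expn1 /tail -nneseriesZl; last first.
      by move=> i _; rewrite lee_fin (sd_ge0 sr).
    apply: lee_nneseries => i _; first by rewrite lee_fin.
    by rewrite -EFinM lee_fin mulrC ler_pdivlMr// mulrC.
split=> //; apply/(FA_property_log_tail rhob rho0 sr (lty _ lr1)).
apply: (box_tail sd l1 Eb eE rhob rho0 sr lr1) => //.
exact: (product_box rb r0 sd l1 Eb eE rhoT).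
Qed.
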